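(* Let $\mathcal Q$ be a locally finite quiver satisfying (A) and (B) of the context, let $\mathcal R$ be the category of finitely presented representations of $\mathcal Q$ over $k=\mathbb F_q$, $\mathcal P\subset\mathcal R$ the full subcategory of projective objects, and $\mathcal A\subset\mathcal R$ the full subcategory of objects $A$ such that $\operatorname{Hom}_{\mathcal R}(M,A)$ is a finite set for every $M\in\mathcal R$. Then the triple $(\mathcal R,\mathcal P,\mathcal A)$ satisfies: (a) $\mathcal R$ is essentially small and linear over $k$; (b) $\mathcal R$ is hereditary, that is, of global dimension at most 1, and has enough projectives; (c) for any $P,Q,M\in\mathcal P$, $M\oplus P\cong M\oplus Q$ implies $P\cong Q$; (d) every element of the Grothendieck group $K(\mathcal R)$ is a $\mathbb Q$-linear combination of classes of objects of $\mathcal A$; (e) if $A,B\in\mathcal A$ have the same class in $K(\mathcal R)$, then $|\operatorname{Hom}(P,A)|=|\operatorname{Hom}(P,B)|$ for all $P\in\mathcal P$.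
   Context: $\mathcal Q$ is a locally finite quiver (each vertex meets finitely many edges) with vertex set $I$. Conditions: (A) after deleting all loops, $\mathcal Q$ has no infinite paths $i_0\to i_1\to i_2\to\cdots$ (in particular, $\mathcal Q$ has no oriented cycles other than loops); (B) no vertex of $\mathcal Q$ has exactly one loop. A representation $(V_i,x_\sigma)$ of $\mathcal Q$ over $k$ consists of (possibly infinite-dimensional) $k$-vector spaces $V_i$, $i\in I$, and linear maps $x_\sigma:V_{t(\sigma)}\to V_{h(\sigma)}$ for each edge $\sigma$ from $t(\sigma)$ to $h(\sigma)$. $\operatorname{Rep}_k(\mathcal Q)$ is the abelian category of representations of finite support ($V_i=0$ for almost all $i$); these are regarded as left modules over the path algebra $R=k\mathcal Q$. $\operatorname{Proj}_k(\mathcal Q)$ is the full subcategory of $\operatorname{Rep}_k(\mathcal Q)$ of finitely generated projective $R$-modules. $\mathcal R$ is the full subcategory of $\operatorname{Rep}_k(\mathcal Q)$ of objects $M$ admitting a presentation $P\to Q\to M\to0$ with $P,Q\in\operatorname{Proj}_k(\mathcal Q)$. *)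

(* Defs.v *)
From HB Require Import structures.
From mathcomp Require Import all_boot all_algebra.
From mathcomp Require Import boolp classical_sets functions cardinality.

Set Implicit Arguments.
Unset Strict Implicit.
Unset Printing Implicit Defensive.

Import GRing.Theory.
Local Open Scope classical_set_scope.
Local Open Scope ring_scope.

(* "Small" means: living in the universe of the carriers of vector spaces.
   The type of all representations lives strictly above it, so that
   [essentially_small] below cannot be met by indexing objects by themselves.
   Morphism sets of representations are in [Small] automatically. *)
Notation Small := Type@{GRing.Lmodule.axioms_.u0}.

Record category := Category {
  obj :> Type;
  Mor : obj -> obj -> Type;
  idmor : forall a, Mor a a;
  Comp : forall a b c, Mor b c -> Mor a b -> Mor a c;
  compA : forall a b c d (h : Mor c d) (g : Mor b c) (f : Mor a b),
    Comp h (Comp g f) = Comp (Comp h g) f;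
  compIm : forall a b (f : Mor a b), Comp (idmor b) f = f;
  compmI : forall a b (f : Mor a b), Comp f (idmor a) = f }.

Arguments idmor {_} a.
Arguments Comp {_ _ _ _} _ _.
Notation "g \oc f" := (Comp g f) (at level 40, left associativity).

Definition fullsub (C : category) (P : C -> Prop) : category :=
  @Category {M : C | P M} (fun M N => Mor (sval M) (sval N))
    (fun M => idmor (sval M)) (fun _ _ _ g f => g \oc f)
    (fun _ _ _ _ h g f => compA h g f)
    (fun _ _ f => compIm f) (fun _ _ f => compmI f).

Section CategoryNotions.
Variable C : category.
Implicit Types a b c M N P : C.

Definition isomorphic M N : Prop :=
  exists (f : Mor M N) (g : Mor N M), g \oc f = idmor M /\ f \oc g = idmor N.

Definition epi a b (f : Mor a b) : Prop :=
  forall c (g h : Mor b c), g \oc f = h \oc f -> g = h.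

Definition projective P : Prop :=
  forall a b (f : Mor a b) (g : Mor P b), epi f -> exists h, f \oc h = g.

Definition enough_projectives : Prop :=
  forall M, exists P (f : Mor P M), projective P /\ epi f.

Definition essentially_small : Prop :=
  exists (S : Small) (F : S -> C), forall M, exists s, isomorphic M (F s).

End CategoryNotions.

Record linops (k : nzRingType) (C : category) := LinOps {
  hzero : forall a b : C, Mor a b;
  hadd : forall a b : C, Mor a b -> Mor a b -> Mor a b;
  hscale : forall a b : C, k -> Mor a b -> Mor a b }.

Arguments hzero {k C} l a b.
Arguments hadd {k C} l {a b} _ _.
Arguments hscale {k C} l {a b} _ _.

Section LinearNotions.
Variables (k : nzRingType) (C : category) (L : linops k C).
Implicit Types a b c s M N P : C.

Definition zero_object a : Prop := idmor a = hzero L a a.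

Definition direct_sum a b s : Prop :=
  exists (ia : Mor a s) (ib : Mor b s) (pa : Mor s a) (pb : Mor s b),
  [/\ pa \oc ia = idmor a, pb \oc ib = idmor b,
      pb \oc ia = hzero L a b, pa \oc ib = hzero L b a
    & hadd L (ia \oc pa) (ib \oc pb) = idmor s].

Record is_linear : Prop := IsLinear {
  haddA : forall a b (f g h : Mor a b),
    hadd L f (hadd L g h) = hadd L (hadd L f g) h;
  haddC : forall a b (f g : Mor a b), hadd L f g = hadd L g f;
  hadd0 : forall a b (f : Mor a b), hadd L (hzero L a b) f = f;
  haddN : forall a b (f : Mor a b), exists g, hadd L g f = hzero L a b;
  hscaleA : forall a b x y (f : Mor a b),
    hscale L x (hscale L y f) = hscale L (x * y) f;
  hscale1 : forall a b (f : Mor a b), hscale L 1 f = f;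
  hscaleDr : forall a b x (f g : Mor a b),
    hscale L x (hadd L f g) = hadd L (hscale L x f) (hscale L x g);
  hscaleDl : forall a b x y (f : Mor a b),
    hscale L (x + y) f = hadd L (hscale L x f) (hscale L y f);
  compDl : forall a b c (g g' : Mor b c) (f : Mor a b),
    hadd L g g' \oc f = hadd L (g \oc f) (g' \oc f);
  compDr : forall a b c (g : Mor b c) (f f' : Mor a b),
    g \oc hadd L f f' = hadd L (g \oc f) (g \oc f');
  compZl : forall a b c x (g : Mor b c) (f : Mor a b),
    hscale L x g \oc f = hscale L x (g \oc f);
  compZr : forall a b c x (g : Mor b c) (f : Mor a b),
    g \oc hscale L x f = hscale L x (g \oc f);
  has_zero_object : exists a, zero_object a;
  has_direct_sums : forall a b, exists s, direct_sum a b s }.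

Definition is_kernel a b c (f : Mor a b) (g : Mor b c) : Prop :=
  g \oc f = hzero L a c /\
  forall d (h : Mor d b), g \oc h = hzero L d c -> exists! h', f \oc h' = h.

Definition is_cokernel a b c (f : Mor a b) (g : Mor b c) : Prop :=
  g \oc f = hzero L a c /\
  forall d (h : Mor b d), h \oc f = hzero L a d -> exists! h', h' \oc g = h.

Definition short_exact a b c (f : Mor a b) (g : Mor b c) : Prop :=
  is_kernel f g /\ is_cokernel f g.

(* [pdim_le n M]: M has a projective resolution
   0 -> P_n -> ... -> P_0 -> M -> 0, given by its successive syzygies. *)
Fixpoint pdim_le (n : nat) M : Prop :=
  if n is m.+1 then
    exists N P (f : Mor N P) (g : Mor P M),
      [/\ short_exact f g, projective P & pdim_le m N]
  else projective M.

Definition gldim_le (n : nat) : Prop := forall M, pdim_le n M.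

(* K_S(C) is the free S-module on the objects of C (finitely supported
   functions C -> S) modulo the S-span of [M] - [M'] - [M''] for the short
   exact sequences M' -> M -> M''.  Thus K_int(C) is the Grothendieck group
   K(C), and K_rat(C) is its scalar extension to the rationals (tensor products
   being right exact), the map K(C) -> K_rat(C) sending [M] to [M].  The
   quotient is handled through the equality [Keq].  The free modules are not
   packaged as mathcomp modules, whose carriers would be too small. *)

Section Grothendieck.
Variable S : comNzRingType.

Definition Kclass (M : C) : C -> S := fun N => (`[< N = M >])%:R.

Definition lincomb (n : nat) (c : 'I_n -> S) (M : 'I_n -> C) : C -> S :=
  fun N => \sum_(i < n) c i * Kclass (M i) N.

Record exact_seq := ExactSeq {
  es_sub : C; es_mid : C; es_quo : C;
  es_inj : Mor es_sub es_mid;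
  es_proj : Mor es_mid es_quo;
  es_exact : short_exact es_inj es_proj }.

Definition relator (e : exact_seq) : C -> S :=
  fun N => Kclass (es_mid e) N - Kclass (es_sub e) N - Kclass (es_quo e) N.

Definition Keq (x y : C -> S) : Prop :=
  exists (n : nat) (c : 'I_n -> S) (e : 'I_n -> exact_seq),
    forall N, x N - y N = \sum_(i < n) c i * relator (e i) N.

End Grothendieck.
End LinearNotions.

Record quiver := Quiver {
  vertex : Small;
  edge : Small;
  qtail : edge -> vertex;
  qhead : edge -> vertex }.

Arguments qtail {q} _.
Arguments qhead {q} _.

Section Quivers.
Variable Q : quiver.

Definition locally_finite : Prop :=
  forall i : vertex Q, finite_set [set e : edge Q | qtail e = i \/ qhead e = i].

Definition is_loop (e : edge Q) : Prop := qtail e = qhead e.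

Definition no_infinite_path : Prop :=
  ~ exists p : nat -> edge Q,
      (forall n, ~ is_loop (p n)) /\ (forall n, qhead (p n) = qtail (p n.+1)).

Definition no_single_loop : Prop :=
  ~ exists i : vertex Q, exists! e : edge Q, is_loop e /\ qtail e = i.

End Quivers.

Section Representations.
Variables (k : fieldType) (Q : quiver).

(* No finiteness of the support is required here: these are all the left
   modules over the path algebra (unital with respect to its idempotents). *)
Record rep := Rep {
  space : vertex Q -> lmodType k;
  arrow : forall e : edge Q, {linear space (qtail e) -> space (qhead e)} }.

Record rep_hom (V W : rep) := RepHom {
  rmap : forall i, {linear space V i -> space W i};
  rmapE : forall e v, rmap (qhead e) (arrow V e v) = arrow W e (rmap (qtail e) v) }.

Lemma linear_ext (U V : lmodType k) (f g : {linear U -> V}) :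
  f =1 g -> f = g.
Proof.
case: f g => [f cf] [g cg] /= /funext fg.
case: _ / fg in cg *; congr GRing.Linear.Pack.
case: cf cg => [[a1] [b1]] [[a2] [b2]].
by rewrite (Prop_irrelevance a1 a2) (Prop_irrelevance b1 b2).
Qed.

Lemma rep_hom_ext (V W : rep) (f g : rep_hom V W) :
  (forall i v, rmap f i v = rmap g i v) -> f = g.
Proof.
case: f g => [f fE] [g gE] /= fg.
have efg : f = g.
  by apply: functional_extensionality_dep => i; apply: linear_ext => v; apply: fg.
by case: _ / efg in gE fg *; congr RepHom; apply: Prop_irrelevance.
Qed.

Program Definition rep_id (V : rep) : rep_hom V V :=
  @RepHom V V (fun i => idfun) _.

Program Definition rep_comp (U V W : rep) (g : rep_hom V W) (f : rep_hom U V) :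
  rep_hom U W := @RepHom U W (fun i => rmap g i \o rmap f i) _.
Next Obligation. by rewrite /= !rmapE. Qed.

Program Definition rep_zero (V W : rep) : rep_hom V W :=
  @RepHom V W (fun i => \0) _.
Next Obligation. by rewrite linear0. Qed.

Program Definition rep_add (V W : rep) (f g : rep_hom V W) : rep_hom V W :=
  @RepHom V W (fun i => rmap f i \+ rmap g i) _.
Next Obligation. by rewrite /= !rmapE linearD. Qed.

Program Definition rep_scale (V W : rep) (x : k) (f : rep_hom V W) :
  rep_hom V W := @RepHom V W (fun i => x \*: rmap f i) _.
Next Obligation. by rewrite /= rmapE linearZ. Qed.

Program Definition ModCat : category := @Category rep rep_hom rep_id rep_comp _ _ _.
Next Obligation. exact: rep_hom_ext. Qed.
Next Obligation. exact: rep_hom_ext. Qed.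
Next Obligation. exact: rep_hom_ext. Qed.

Definition fin_supported (V : rep) : Prop :=
  finite_set [set i | exists v : space V i, v != 0].

Definition rep_surj (V W : rep) (f : rep_hom V W) : Prop :=
  forall i w, exists v, rmap f i v = w.

Definition projective_module (P : rep) : Prop :=
  forall (V W : rep) (f : rep_hom V W) (g : rep_hom P W), rep_surj f ->
  exists h : rep_hom P V, rep_comp f h = g.

Definition subrep (V : rep) (U : forall i, set (space V i)) : Prop :=
  [/\ forall i, U i 0,
      forall i (x : k) u v, U i u -> U i v -> U i (x *: u + v)
    & forall e v, U (qtail e) v -> U (qhead e) (arrow V e v)].

(* Homogeneous generators suffice: a submodule contains each of the components
   (e_i v)_i of its elements v. *)
Definition finitely_generated (V : rep) : Prop :=
  exists (n : nat) (s : 'I_n -> vertex Q) (v : forall j, space V (s j)),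
    forall U, subrep U -> (forall j, U (s j) (v j)) -> forall i w, U i w.

Definition in_Proj (P : rep) : Prop :=
  [/\ fin_supported P, finitely_generated P & projective_module P].

Definition right_exact (U V W : rep) (f : rep_hom U V) (g : rep_hom V W) : Prop :=
  rep_surj g /\
  forall i v, rmap g i v = 0 <-> exists u, rmap f i u = v.

Definition finitely_presented (M : rep) : Prop :=
  exists (P P' : rep) (f : rep_hom P P') (g : rep_hom P' M),
    [/\ in_Proj P, in_Proj P' & right_exact f g].

Definition Rcat : category :=
  @fullsub ModCat (fun M => fin_supported M /\ finitely_presented M).

Definition Rlin : linops k Rcat :=
  @LinOps k Rcat (fun M N => rep_zero (sval M) (sval N))
    (fun M N => @rep_add (sval M) (sval N))
    (fun M N => @rep_scale (sval M) (sval N)).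

Definition hom_finite (A : Rcat) : Prop :=
  forall M : Rcat, finite_set [set: Mor M A].

End Representations.

(* Main.v *)
Require Import Defs.
From HB Require Import structures.
From mathcomp Require Import all_boot all_algebra.
From mathcomp Require Import boolp classical_sets functions cardinality finmap.
From mathcomp Require Import fingroup perm.

Set Implicit Arguments.
Unset Strict Implicit.
Unset Printing Implicit Defensive.

Local Open Scope classical_set_scope.
Local Open Scope ring_scope.
Local Notation space := Defs.space.

Import GRing.Theory.

(** The projective [P_i] generated at a vertex [i] consists of the combinations of
    paths starting at [i], and [Hom (P_i, M) = M_i]. It has finite support, as
    a vertex reaches finitely many others: the quiver is locally finite and has no
    infinite path of non-loops. The theorem rests on two facts about free
    representations, that is, finite direct sums [F] of such [P_i].

    The first is that finitely generated subrepresentations of [F] are free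
    ([image_free]). Generators of minimal total degree are independent, because
    the leading terms in a relation between them would show how to lower the
    degree of one of them ([reduced_inj]). Hence every object [M] of [R] has a
    resolution [0 -> F' -> F -> M -> 0] with [F] and [F'] free ([resolution]): so
    [R] is essentially small, has enough projectives and global dimension at
    most 1. Projective objects, being retracts of free ones, are free
    ([retract_free]). These module-theoretic statements carry over to the category
    [R] because [R] contains the cokernels of its morphisms ([coker_inR]), so that
    its epimorphisms are onto and its short exact sequences are exact at each
    vertex ([short_exact_exact]).

    The second is that the multiplicities in [F] extend to additive functions on
    all of [R]. For a vertex [i], let [D_M] be the sum of the maps
    [M_(qtail e) -> M_i] over the edges [e] that end at [i]. If [M] is free, [D_M]
    is injective and its cokernel has as basis the generators at [i], since a
    path is trivial or has a last edge. So [D_M] has finite kernel and cokernel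
    for every [M] in [R], and the dimension of the cokernel minus that of the
    kernel is additive on short exact sequences. Over a finite field it can be
    read off from the sizes of finite sets, through their prime valuations, which
    is the form used below ([log_indexD]). This yields the cancellation
    property ([free_cancel]). For [A] with finite spaces
    the index is [dim A_i] minus the sum of the [dim A_(qtail e)], with one
    term [dim A_i] for each of the [g] loops at [i]. As [g] is not 1, the indices
    determine the [dim A_i], by induction from the vertices of highest rank down
    ([Keq_size]), and with them the number of morphisms from any free
    representation to [A].

    Finally, the simple representation [S_i] has a free resolution in which [P_i]
    occurs once in degree 0 and [g] times in degree 1 ([simple_exact]). So
    [(1 - g) [P_i]] is [[S_i]] plus classes of projectives generated at
    vertices of lower rank, and by induction the classes of the [S_i] span the
    Grothendieck group over the rationals ([hf_span_pt]). *)

(** * Edges, ranks of vertices, and reachable vertices *)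

Section QuiverCombinatorics.
Variable Q : quiver.
Hypothesis lfQ : locally_finite Q.
Local Notation E := {classic (edge Q)}.

Lemma edge_list (A : set (edge Q)) : finite_set A ->
  exists2 l : seq E, uniq l & forall e : E, e \in l = `[<A e>].
Proof.
move=> finA; have /finite_seqP[l lE] : finite_set (A : set E) by [].
exists (undup l); rewrite ?undup_uniq// => e; rewrite mem_undup lE.
by apply/idP/asboolP.
Qed.

Lemma in_edges_subproof i :
  exists2 l : seq E, uniq l & forall e : E, e \in l = `[<qhead e = i>].
Proof. by apply: edge_list; apply: sub_finite_set (lfQ i) => e; right. Qed.

Definition in_edges i : seq E := s2val (cid2 (in_edges_subproof i)).

Lemma in_edges_uniq i : uniq (in_edges i).
Proof. by rewrite /in_edges; case: cid2. Qed.

Lemma mem_in_edges i (e : E) : (e \in in_edges i) = `[<qhead e = i>].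
Proof. by rewrite /in_edges; case: cid2. Qed.

Lemma out_edges_subproof i :
  exists2 l : seq E, uniq l & forall e : E, e \in l = `[<qtail e = i>].
Proof. by apply: edge_list; apply: sub_finite_set (lfQ i) => e; left. Qed.

Definition out_edges i : seq E := s2val (cid2 (out_edges_subproof i)).

Lemma out_edges_uniq i : uniq (out_edges i).
Proof. by rewrite /out_edges; case: cid2. Qed.

Lemma mem_out_edges i (e : E) : (e \in out_edges i) = `[<qtail e = i>].
Proof. by rewrite /out_edges; case: cid2. Qed.

Hypothesis no_path : no_infinite_path Q.

(** [short n i]: every path of non-loops from [i] has fewer than [n] edges. *)
Fixpoint short (n : nat) (i : vertex Q) : Prop :=
  if n is m.+1 then
    forall e, qtail e = i -> ~ is_loop e -> short m (qhead e)
  else False.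

Lemma shortS n i : short n i -> short n.+1 i.
Proof. by elim: n i => [//|n IHn] i /= si e te le; apply: IHn; apply: si. Qed.

Lemma short_leq m n i : (m <= n)%N -> short m i -> short n i.
Proof. by move=> /subnK <-; elim: (_ - _)%N => [//|d IHd] /IHd /shortS. Qed.

(** König's lemma: by local finiteness, a vertex from which the paths are
    unboundedly long has a successor with the same property, and choosing such
    successors repeatedly builds an infinite path. *)
Lemma short_exists i : exists n, short n i.
Proof.
pose bad j := ~ exists n, short n j.
have step j : bad j -> {e : edge Q | [/\ qtail e = j, ~ is_loop e & bad (qhead e)]}.
  move=> badj; apply: cid; apply: contrapT => noe; apply: badj.
  have bnd (e : E) : exists n, qtail e = j -> ~ is_loop e -> short n (qhead e).
    have [[n sn]|nsn] := pselect (exists n, short n (qhead e)).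
      by exists n.
    by exists 0 => te le; case: noe; exists e.
  exists (\max_(e <- out_edges j) projT1 (cid (bnd e)))%N.+1 => /= e te le.
  apply: short_leq (projT2 (cid (bnd e)) te le).

  apply: (@leq_bigmax_seq _ _ _ (fun e => projT1 (cid (bnd e)))) => //.
  by rewrite mem_out_edges; apply/asboolP.
apply: contrapT => badi.
pose T := {j | bad j}.
pose nxt (t : T) : T :=
  let s := step (sval t) (svalP t) in
  let: And3 _ _ b := svalP s in exist _ (qhead (sval s)) b.
pose t n := iter n nxt (exist _ i badi : T).
have nxtE (u : T) : sval (nxt u) = qhead (sval (step _ (svalP u))).
  by rewrite /nxt; case: svalP.
apply: no_path; exists (fun n => sval (step _ (svalP (t n)))); split=> n.
  by case: (svalP (step _ (svalP (t n)))).
rewrite -nxtE.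
by case: (svalP (step _ (svalP (t n.+1)))) => ->.
Qed.

(** The rank of a vertex is given by the longest path of non-loops from it; this is
    what the inductions over the vertices of the quiver run on. *)
Lemma exists_rank : exists h : vertex Q -> nat,
  forall e, ~ is_loop e -> (h (qhead e) < h (qtail e))%N.
Proof.
have ex i : exists n, `[< short n i >].
  by have [n sn] := short_exists i; exists n; apply/asboolP.
exists (fun i => ex_minn (ex i)) => e le.
case: ex_minnP => m sm mmin; case: ex_minnP => -[|n] /asboolP //= sn _.
by rewrite ltnS; apply: mmin; apply/asboolP; apply: sn.
Qed.

(** The set reached from [i] is that of its successors along non-loops, together
    with [i] itself; it bounds the support of the projective generated at [i]. *)
Lemma finite_reach i : exists S : set (vertex Q),
  [/\ finite_set S, S i & forall e, S (qtail e) -> S (qhead e)].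
Proof.
have [h hP] := exists_rank.
elim: {i}(h i).+1 {-2}i (ltnSn (h i)) => [//|n IHn] i; rewrite ltnS => hi.
have ex (e : E) : {S : set (vertex Q) | qtail e = i -> ~ is_loop e ->
    [/\ finite_set S, S (qhead e) & forall e', S (qtail e') -> S (qhead e')]}.
  apply: cid; have [[te le]|nte] := pselect (qtail e = i /\ ~ is_loop e).
    have [|S SP] := IHn (qhead e); last by exists S.
    by apply: leq_trans hi; rewrite -te; exact: hP.
  by exists set0 => te le; case: nte.
pose D := [set e : E | qtail e = i /\ ~ is_loop e].
exists ([set i] `|` \bigcup_(e in D) sval (ex e)); split.
- rewrite finite_setU; split; first exact: finite_set1.
  apply: bigcup_finite => [|e [te le]]; last by case: (svalP (ex e) te le).
  by apply: sub_finite_set (lfQ i) => e [te _]; left.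
- by left.
move=> e [/= te|[e' De' Se]]; last first.
  right; exists e' => //; case: De' => te' le'.
  by case: (svalP (ex e') te' le') => _ _ /(_ _ Se).
have [le|le] := pselect (is_loop e); first by left; rewrite /= -te -le.
by right; exists e => //; case: (svalP (ex e) te le).
Qed.

End QuiverCombinatorics.

(** * Transport between the spaces at equal vertices *)

Section Casts.
Variables (k : fieldType) (I : Type).
Implicit Types T : I -> lmodType k.

(** Transport along [i = j], extended by zero when [i] and [j] differ: a total
    linear map, so that sums over edges or generators need no side condition on
    their endpoints. *)
Definition vcast (T : I -> lmodType k) i j (v : T i) : T j :=
  if pselect (i = j) is left e then eq_rect i (fun x => T x : Type) v j e else 0.

Fact vcast_linear T i j : linear (@vcast T i j).
Proof.
move=> a u v; rewrite /vcast; case: pselect => [e|_]; first by case: _ / e.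
by rewrite scaler0 addr0.
Qed.
HB.instance Definition _ T i j :=
  GRing.isLinear.Build k (T i) (T j) _ (@vcast T i j) (@vcast_linear T i j).

Lemma vcast_id T i (v : T i) : vcast i v = v.
Proof. by rewrite /vcast; case: pselect => // e; rewrite (Prop_irrelevance e erefl). Qed.

Lemma vcast_neq T i j (v : T i) : i <> j -> vcast j v = 0.
Proof. by rewrite /vcast; case: pselect. Qed.

Lemma vcast_trans T i j l (v : T i) : i = j -> vcast l (vcast j v) = vcast l v.
Proof. by move=> e; case: _ / e; rewrite vcast_id. Qed.

Lemma vcast_map (T U : I -> lmodType k) (f : forall i, {linear T i -> U i}) i j v :
  f j (vcast j v) = vcast j (f i v).
Proof.
rewrite /vcast; case: pselect => [e|_]; first by case: _ / e.
by rewrite linear0.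
Qed.

End Casts.

Section Arr.
Variables (k : fieldType) (Q : quiver).

(** The action of the edge [e] with values in the space at any vertex [i], zero
    unless [e] ends at [i]: it spares transports along [qhead e = i]. *)
Definition arr (V : rep k Q) (e : edge Q) i (v : space V (qtail e)) : space V i :=
  vcast i (arrow V e v).

Fact arr_linear (V : rep k Q) e i : linear (@arr V e i).
Proof. by move=> a u v; rewrite /arr !linearP. Qed.
HB.instance Definition _ (V : rep k Q) e i :=
  GRing.isLinear.Build k _ _ _ (@arr V e i) (@arr_linear V e i).

Lemma arrE (V : rep k Q) e v : @arr V e (qhead e) v = arrow V e v.
Proof. exact: vcast_id. Qed.

Lemma arr_map (V W : rep k Q) (f : rep_hom V W) e i v :
  rmap f i (arr i v) = @arr W e i (rmap f (qtail e) v).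
Proof. by rewrite /arr -rmapE vcast_map. Qed.

End Arr.

(** * Free representations *)

Section FreeRepresentations.
Variables (k : fieldType) (Q : quiver).
Local Notation E := {classic (edge Q)}.

(** [route a p b]: the edges of [p], listed from the last to the first, form a
    path from [a] to [b]. *)
Fixpoint route (a : vertex Q) (p : seq E) (b : vertex Q) : Prop :=
  if p is e :: p' then qhead e = b /\ route a p' (qtail e) else a = b.

Section Space.
Variables (J : finType) (s : J -> vertex Q) (i : vertex Q).

(** The degree is one more than the length of the longest path that occurs, so
    that only 0 has degree at most 0. *)
Definition fun_deg_le (d : nat) (f : J -> seq E -> k^o) : Prop :=
  forall j p, (d <= size p)%N -> f j p = 0.

Lemma fun_deg_leW d d' f : (d <= d')%N -> fun_deg_le d f -> fun_deg_le d' f.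
Proof. by move=> dd' fd j p /(leq_trans dd')/fd. Qed.

Lemma fun_deg_leP d a f g :
  fun_deg_le d f -> fun_deg_le d g -> fun_deg_le d (a *: f + g).
Proof.
move=> fd gd j p dp; rewrite -[LHS]/(a *: f j p + g j p).
by rewrite fd// gd// scaler0 addr0.
Qed.

(** Bounded length implies finite support here, since a vertex meets finitely
    many edges; the bound is what inductions use. *)
Definition free_pred : {pred J -> seq E -> k^o} := fun f =>
  `[< (forall j p, f j p != 0 -> route (s j) p i) /\ exists d, fun_deg_le d f >].

Fact free_pred_closed : submod_closed free_pred.
Proof.
split=> [|a f g].
  by apply/asboolP; split=> [j p /eqP//|]; exists 0.
move=> /asboolP[fr [df fd]] /asboolP[gr [dg gd]]; apply/asboolP; split.
  move=> j p; have [|/fr//] := eqVneq (f j p) 0.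
  have [|/gr//] := eqVneq (g j p) 0.
  rewrite -[(a *: f + g) j p]/(a *: f j p + g j p) => -> ->.
  by rewrite scaler0 addr0 eqxx.
exists (maxn df dg); apply: fun_deg_leP.
  by apply: fun_deg_leW fd; rewrite leq_maxl.
by apply: fun_deg_leW gd; rewrite leq_maxr.
Qed.
HB.instance Definition _ := GRing.isSubmodClosed.Build _ _ free_pred free_pred_closed.

Record free_space := FreeElt {
  coefs :> J -> seq E -> k^o;
  coefsP : coefs \in free_pred }.

HB.instance Definition _ := [isSub for coefs].
HB.instance Definition _ := [Choice of free_space by <:].
HB.instance Definition _ := [SubChoice_isSubLmodule of free_space by <:].

Lemma free_ext (f g : free_space) : (forall j p, f j p = g j p) -> f = g.
Proof. by move=> fg; apply: val_inj; apply/funext => j; apply/funext => p. Qed.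

Lemma free_route (f : free_space) j p : f j p != 0 -> route (s j) p i.
Proof. by have /asboolP[fr _] := coefsP f; exact: fr. Qed.

Definition deg_le d (f : free_space) := fun_deg_le d f.

Lemma deg_exists (f : free_space) : exists d, deg_le d f.
Proof. by have /asboolP[_ [d fd]] := coefsP f; exists d. Qed.

Lemma deg_leP d a f g : deg_le d f -> deg_le d g -> deg_le d (a *: f + g).
Proof. exact: fun_deg_leP. Qed.

End Space.

Section Rep.
Variables (J : finType) (s : J -> vertex Q).

Definition cons_fun (e : edge Q) (f : J -> seq E -> k^o) : J -> seq E -> k^o :=
  fun j p => if p is e' :: p' then if e' == (e : E) then f j p' else 0 else 0.

Definition behead_fun (e : edge Q) (f : J -> seq E -> k^o) : J -> seq E -> k^o :=
  fun j p => f j ((e : E) :: p).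

Fact cons_subproof e (f : free_space s (qtail e)) :
  cons_fun e f \in free_pred s (qhead e).
Proof.
apply/asboolP; split=> [j [|e' p]/=|]; rewrite ?eqxx//.
  by case: (e' =P e) => [-> /free_route|_]; rewrite ?eqxx.
have [d fd] := deg_exists f; exists d.+1 => j [|e' p]//=.
by case: (e' =P _) => // _ dp; exact: fd.
Qed.
Definition free_cons e f := FreeElt (@cons_subproof e f).

Fact cons_linear e : linear (@free_cons e).
Proof.
move=> a f g; apply: free_ext => j [|e' p]; 
  rewrite -[RHS]/(a * cons_fun e f j _ + cons_fun e g j _)/=.
  by rewrite mulr0 addr0.
by case: (e' =P _) => // _; rewrite mulr0 addr0.
Qed.
HB.instance Definition _ e := GRing.isLinear.Build k _ _ _ _ (@cons_linear e).

(** The representation of functions on the paths starting at the [s j], of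
    bounded length: the direct sum of the projectives generated at the [s j]. *)
Definition freeRep : rep k Q := Rep (space := fun i => free_space s i)
  (fun e => free_cons (e := e)).

Definition coef i (f : space freeRep i) j p : k := (f : free_space s i) j p.

Arguments coef : simpl never.

Lemma coefs_linear i a (f g : space freeRep i) :
  coefs (a *: f + g : space freeRep i) = a *: coefs f + coefs g.
Proof. by []. Qed.

Section Coefs.
Variable i : vertex Q.
Implicit Types f g : space freeRep i.
Lemma coefD f g j p : coef (f + g) j p = coef f j p + coef g j p.
Proof. by []. Qed.
Lemma coefB f g j p : coef (f - g) j p = coef f j p - coef g j p.
Proof. by []. Qed.
Lemma coefZ a f j p : coef (a *: f) j p = a * coef f j p.
Proof. by []. Qed.
Lemma coef0 j p : coef (0 : space freeRep i) j p = 0.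
Proof. by []. Qed.
Lemma coef_sum (T : Type) (r : seq T) (P : pred T) (F : T -> space freeRep i) j p :
  coef (\sum_(x <- r | P x) F x) j p = \sum_(x <- r | P x) coef (F x) j p.
Proof. by elim/big_rec2: _ => // x y f _ <-; rewrite coefD. Qed.
End Coefs.

Fact behead_subproof e i (f : free_space s i) :
  behead_fun e f \in free_pred s (qtail e).
Proof.
apply/asboolP; split=> [j p /free_route[]//|].
have [d fd] := deg_exists f; exists d => j p dp.
by apply: fd; rewrite /= ltnW.
Qed.

(** The coefficient of the last edge [e]: a left inverse of the action of [e]
    which vanishes on the images of the other edges. *)
Definition del e i f : space freeRep (qtail e) := FreeElt (@behead_subproof e i f).

Fact del_linear e i : linear (@del e i).
Proof. by move=> a f g; apply: free_ext. Qed.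
HB.instance Definition _ e i := GRing.isLinear.Build k _ _ _ _ (@del_linear e i).

Definition gen_fun (j0 : J) : J -> seq E -> k^o :=
  fun j p => ((j == j0) && nilp p)%:R.

Fact gen_subproof j : gen_fun j \in free_pred s (s j).
Proof.
apply/asboolP; split=> [j' [|e p]/=|].
- by rewrite /gen_fun; case: (j' =P j) => [->//|_]; rewrite eqxx.
- by rewrite /gen_fun andbF eqxx.
by exists 1 => j' [|e p]//= _; rewrite /gen_fun andbF.
Qed.

Definition gen j : space freeRep (s j) := FreeElt (gen_subproof j).

Lemma coef_ext i (f g : space freeRep i) : (forall j p, coef f j p = coef g j p) -> f = g.
Proof. exact: free_ext. Qed.

Lemma coef_route i (f : space freeRep i) j p : coef f j p != 0 -> route (s j) p i.
Proof. exact: free_route. Qed.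

Lemma coef_vcast i i' (f : space freeRep i) j p : i = i' ->
  coef (vcast i' f : space freeRep i') j p = coef f j p.
Proof. by move=> ii'; case: _ / ii'; rewrite vcast_id. Qed.

Lemma coef_arr e i (f : space freeRep (qtail e)) j p : qhead e = i ->
  coef (arr i f : space freeRep i) j p =
    if p is e' :: p' then if e' == (e : E) then coef f j p' else 0 else 0.
Proof. by move=> ei; case: _ / ei; rewrite arrE. Qed.

Lemma coef_del e i (f : space freeRep i) j p :
  coef (del e f) j p = coef f j ((e : E) :: p).
Proof. by []. Qed.

Lemma coef_genE j0 j p : coef (gen j0) j p = ((j == j0) && nilp p)%:R.
Proof. by []. Qed.

Lemma coef_gen i j0 j p :
  coef (vcast i (gen j0) : space freeRep i) j p =
    ([&& `[< s j = i >], j == j0 & nilp p])%:R.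
Proof.
have [e|ne] := pselect (s j0 = i).
  rewrite coef_vcast// /coef /= /gen_fun.
  by case: eqP => [->|_]; rewrite ?andbF// asboolT.
rewrite vcast_neq// coef0.
by case: eqP => [->|_]; rewrite ?andbF// asboolF.
Qed.

Hypothesis lfQ : locally_finite Q.
Local Notation in_edges := (in_edges lfQ).

(** A path is either trivial or has a last edge, which is one of the finitely
    many edges ending where the path does. *)
Lemma free_decomp i (f : space freeRep i) :
  f = \sum_j coef f j [::] *: vcast i (gen j) +
      \sum_(e <- in_edges i) arr i (del e f).
Proof.
apply: coef_ext => j p; rewrite coefD !coef_sum.
have Egen: \sum_(x : J) coef (coef f x [::] *: vcast i (gen x) : space freeRep i) j p =
    if p is [::] then coef f j [::] else 0.
  rewrite (bigD1 j)//= big1 => [|j' jj']; last first.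
    by rewrite coefZ coef_gen eq_sym (negPf jj') andbF mulr0.
  rewrite addr0 coefZ coef_gen eqxx/=; case: p => [|e p]; last first.
    by rewrite andbF mulr0.
  have [|/coef_route/=e] := eqVneq (coef f j [::]) 0; first by move=> ->; rewrite mul0r.
  by rewrite asboolT// mulr1.
rewrite Egen {Egen}; case: p => [|e p].
  rewrite big1_seq ?addr0// => e; rewrite mem_in_edges => /asboolP ei.
  by rewrite coef_arr.
rewrite add0r; have [ei|nei] := pselect (qhead e = i).
  rewrite (bigD1_seq (e : E)) ?in_edges_uniq ?mem_in_edges ?asboolT//=.
  rewrite coef_arr//= eqxx big1_seq ?addr0// => e'.
  rewrite mem_in_edges => /andP[ne' /asboolP e'i].
  by rewrite coef_arr//= eq_sym (negPf ne').
rewrite big1_seq => [|e']; last first.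
  rewrite mem_in_edges => /asboolP e'i; rewrite coef_arr//=.
  by case: (e =P e') nei => [->|].
by have [//|/coef_route[/nei]] := eqVneq (coef f j (e :: p)) 0.
Qed.

Lemma arr_del e i (f : space freeRep (qtail e)) : qhead e = i ->
  del e (arr i f : space freeRep i) = f.
Proof. by move=> ei; apply: coef_ext => j p; rewrite coef_del coef_arr// eqxx. Qed.

Lemma arr_del_neq e e' i (f : space freeRep (qtail e)) : qhead e = i ->
  (e : E) != e' -> del e' (arr i f : space freeRep i) = 0.
Proof.
move=> ei ne; apply: coef_ext => j p.
by rewrite coef_del coef_arr// eq_sym (negPf ne).
Qed.

End Rep.
End FreeRepresentations.
Arguments coef : simpl never.

(** * The universal property of free representations *)

Section UniversalProperty.
Variables (k : fieldType) (Q : quiver).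
Hypothesis lfQ : locally_finite Q.
Local Notation E := {classic (edge Q)}.
Local Notation in_edges := (in_edges lfQ).

Lemma deg_le_del (J : finType) (s : J -> vertex Q) d i (f : space (freeRep k s) i) e :
  deg_le d.+1 f -> deg_le d (del e f).
Proof. by move=> fd j p dp; exact: fd. Qed.

Lemma deg_le0 (J : finType) (s : J -> vertex Q) i (f : space (freeRep k s) i) :
  deg_le 0 f -> f = 0.
Proof. by move=> f0; apply: coef_ext => j p; rewrite coef0; apply: f0. Qed.

Section Lift.
Variables (J : finType) (s : J -> vertex Q) (V : rep k Q).
Variable v : forall j, space V (s j).

(** The value at [f] of the morphism sending the generators to the [v j], for
    [f] of degree at most [d]. *)
Fixpoint lift_fuel (d : nat) i (f : J -> seq E -> k^o) : space V i :=
  if d is d'.+1 then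
    \sum_j (f j [::] : k) *: vcast i (v j) +
    \sum_(e <- in_edges i) arr i (lift_fuel d' (qtail e) (behead_fun e f))
  else 0.

Lemma lift_fuel_linear d i : linear (lift_fuel d i).
Proof.
elim: d i => [|d IHd] i a f g /=; first by rewrite scaler0 addr0.
rewrite scalerDr !scaler_sumr addrACA -!big_split /=; congr (_ + _).
  by apply: eq_bigr => j _; rewrite scalerA -scalerDl.
apply: eq_bigr => e _.
by rewrite -[behead_fun e _]/(a *: behead_fun e f + behead_fun e g) IHd linearP.
Qed.

Lemma lift_fuel_stable d d' i f : (d <= d')%N -> fun_deg_le d f ->
  lift_fuel d' i f = lift_fuel d i f.
Proof.
elim: d' d i f => [|d' IHd] [|d] i f //= dd' fd.
  rewrite big1 => [|j _]; last by rewrite fd// scale0r.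
  rewrite big1 ?addr0// => e _; rewrite (IHd 0%N) ?linear0//.
  by move=> j p _; apply: fd.
congr (_ + _); apply: eq_bigr => e _; congr arr.
by apply: IHd => // j p dp; apply: fd.
Qed.

Definition lift_fun i (f : space (freeRep k s) i) : space V i :=
  lift_fuel (sval (cid (deg_exists f))) i (f : free_space k s i).

Lemma lift_funE d i (f : space (freeRep k s) i) : deg_le d f ->
  lift_fun f = lift_fuel d i (f : free_space k s i).
Proof.
move=> fd; rewrite /lift_fun; case: cid => d' fd' /=.
have [dd'|/ltnW d'd] := leqP d d'; last symmetry; exact: lift_fuel_stable.
Qed.

Fact lift_fun_linear i : linear (@lift_fun i).
Proof.
move=> a f g; have [df fd] := deg_exists f; have [dg gd] := deg_exists g.
have {}fd : deg_le (maxn df dg) f by apply: fun_deg_leW fd; rewrite leq_maxl.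
have {}gd : deg_le (maxn df dg) g by apply: fun_deg_leW gd; rewrite leq_maxr.
rewrite (lift_funE fd) (lift_funE gd) (lift_funE (deg_leP a fd gd)).
by rewrite coefs_linear lift_fuel_linear.
Qed.
HB.instance Definition _ i := GRing.isLinear.Build k _ _ _ (@lift_fun i)
  (@lift_fun_linear i).

Lemma lift_fun_rec i (f : space (freeRep k s) i) :
  lift_fun f = \sum_j coef f j [::] *: vcast i (v j) +
    \sum_(e <- in_edges i) arr i (lift_fun (del e f)).
Proof.
have [d fd] := deg_exists f.
have {}fd : deg_le d.+1 f by apply: fun_deg_leW fd.
rewrite (lift_funE fd) /=; congr (_ + _); apply: eq_bigr => e _.
by rewrite (lift_funE (deg_le_del e fd)).
Qed.

Fact lift_arrow e f :
  lift_fun (arrow (freeRep k s) e f) = arrow V e (lift_fun f).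
Proof.
rewrite -arrE -[RHS]arrE lift_fun_rec big1 ?add0r => [|j _]; last first.
  by rewrite coef_arr// scale0r.
rewrite (bigD1_seq (e : E)) ?in_edges_uniq ?mem_in_edges ?asboolT//=.
rewrite arr_del// big1 ?addr0// => e' ne.
by rewrite arr_del_neq 1?eq_sym// !linear0.
Qed.

Definition free_lift : rep_hom (freeRep k s) V := RepHom lift_arrow.

Lemma lift_gen j : rmap free_lift (s j) (gen k s j) = v j.
Proof.
rewrite /= lift_fun_rec [X in _ + X]big1_seq ?addr0 => [|e]; last first.
  rewrite mem_in_edges => /asboolP ej; rewrite [del e _](_ : _ = 0) ?linear0//.
  apply: coef_ext => j' p; rewrite coef_del coef0.
  by rewrite coef_genE andbF.
rewrite (bigD1 j)//= big1 ?addr0 => [|j' jj'].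
  by rewrite coef_genE eqxx scale1r vcast_id.
by rewrite coef_genE (negPf jj') scale0r.
Qed.

End Lift.

Section HomExtensionality.
Variables (J : finType) (s : J -> vertex Q) (V : rep k Q).
Implicit Types g h : rep_hom (freeRep k s) V.

Lemma free_hom_decomp g i f :
  rmap g i f = \sum_j coef f j [::] *: vcast i (rmap g (s j) (gen k s j)) +
    \sum_(e <- in_edges i) arr i (rmap g (qtail e) (del e f)).
Proof.
rewrite {1}(free_decomp lfQ f) linearD !linear_sum; congr (_ + _).
  by apply: eq_bigr => j _; rewrite linearZ/= (vcast_map (rmap _)).
by apply: eq_bigr => e _; rewrite arr_map.
Qed.

(** Only the generators that occur in [f] matter for the value at [f]. *)
Lemma free_hom_eq_on g h i f :
  (forall j, (forall p, coef f j p = 0) \/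
    rmap g (s j) (gen k s j) = rmap h (s j) (gen k s j)) ->
  rmap g i f = rmap h i f.
Proof.
have [d] := deg_exists f; elim: d i f => [|d IHd] i f fd gh.
  by rewrite (deg_le0 fd) !linear0.
rewrite [LHS]free_hom_decomp [RHS]free_hom_decomp; congr (_ + _).
  by apply: eq_bigr => j _; have [->|->] := gh j; rewrite ?scale0r.
apply: eq_bigr => e _; rewrite IHd//; first exact: deg_le_del.
by move=> j; have [f0|] := gh j; [left => p; rewrite coef_del | right].
Qed.

Lemma free_hom_ext g h :
  (forall j, rmap g (s j) (gen k s j) = rmap h (s j) (gen k s j)) -> g = h.
Proof.
by move=> gh; apply: rep_hom_ext => i f; apply: free_hom_eq_on => j; right.
Qed.

End HomExtensionality.

(** Removing last edges commutes with a homomorphism up to the constant terms. *)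
Lemma del_hom (J K : finType) (t : J -> vertex Q) (s : K -> vertex Q)
    (f : rep_hom (freeRep k t) (freeRep k s)) e i x :
  del e (rmap f i x) =
    \sum_j coef x j [::] *: del e (vcast i (rmap f _ (gen k t j))) +
    rmap f (qtail e) (del e x).
Proof.
rewrite free_hom_decomp linearD !linear_sum.
congr (_ + _); first by apply: eq_bigr => j _; rewrite linearZ.
have [ei|ei] := pselect (qhead e = i).
  rewrite (bigD1_seq (e : E)) ?in_edges_uniq ?mem_in_edges ?asboolT//=.
  rewrite arr_del// big1_seq ?addr0// => e'; rewrite mem_in_edges.
  by case/andP => ne /asboolP e'i; rewrite arr_del_neq.
have -> : del e x = 0.
  apply: coef_ext => j p; rewrite coef_del coef0.
  by have [//|/coef_route[]] := eqVneq (coef x j ((e : E) :: p)) 0.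
rewrite linear0 big1_seq// => e'; rewrite mem_in_edges => /asboolP e'i.
by rewrite /= arr_del_neq//; apply/eqP => ee'; apply: ei; rewrite -ee'.
Qed.

End UniversalProperty.

(** * Factoring homomorphisms of representations *)

Section Modules.
Variables (k : fieldType) (Q : quiver).
Implicit Types U V W : rep k Q.

Definition rep_inj V W (f : rep_hom V W) : Prop :=
  forall i v, rmap f i v = 0 -> v = 0.

Definition im_sub U V W (f : rep_hom U W) (g : rep_hom V W) : Prop :=
  forall i u, exists v, rmap g i v = rmap f i u.

Definition exact_pair U V W (f : rep_hom U V) (g : rep_hom V W) : Prop :=
  rep_inj f /\ right_exact f g.

Lemma rep_injP V W (f : rep_hom V W) : rep_inj f -> forall i, injective (rmap f i).
Proof.
by move=> fi i u v fuv; apply/subr0_eq/fi; rewrite linearB fuv subrr.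
Qed.

Lemma rep_comp_id_inj V W (f : rep_hom V W) (g : rep_hom W V) :
  rep_comp g f = rep_id V -> rep_inj f.
Proof.
move=> gf i v fv; have := congr1 (fun h : rep_hom V V => rmap h i v) gf.
by rewrite /= fv linear0.
Qed.

Lemma rep_comp_id_surj V W (f : rep_hom V W) (g : rep_hom W V) :
  rep_comp g f = rep_id V -> rep_surj g.
Proof.
move=> gf i v; exists (rmap f i v).
by have := congr1 (fun h : rep_hom V V => rmap h i v) gf.
Qed.

Lemma rep_compA U V W X (h : rep_hom W X) (g : rep_hom V W) (f : rep_hom U V) :
  rep_comp h (rep_comp g f) = rep_comp (rep_comp h g) f.
Proof. exact: rep_hom_ext. Qed.

Lemma rep_compE U V W (g : rep_hom V W) (f : rep_hom U V) h :
  rep_comp g f = h -> forall i u, rmap g i (rmap f i u) = rmap h i u.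
Proof. by move=> <-. Qed.

Lemma factor_inj U V W (f : rep_hom U W) (g : rep_hom V W) :
  rep_inj g -> im_sub f g -> exists h : rep_hom U V, rep_comp g h = f.
Proof.
move=> gi fg; pose h i u := sval (cid (fg i u)).
have hP i u : rmap g i (h i u) = rmap f i u by rewrite /h; case: cid.
have hl i : linear (h i).
  by move=> a u v; apply: (rep_injP gi); rewrite linearP !hP linearP.
pose hL i : {linear space U i -> space V i} :=
  HB.pack (h i) (GRing.isLinear.Build k _ _ _ (h i) (hl i)).
have hE e v : hL (qhead e) (arrow U e v) = arrow V e (hL (qtail e) v).
  by apply: (rep_injP gi); rewrite /= hP !rmapE hP.
by exists (RepHom hE); apply: rep_hom_ext => i u /=; rewrite hP.
Qed.

Lemma factor_surj V W X (g : rep_hom V W) (f : rep_hom V X) :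
  rep_surj g -> (forall i v, rmap g i v = 0 -> rmap f i v = 0) ->
  exists h : rep_hom W X, rep_comp h g = f.
Proof.
move=> gs gf; pose h i w := rmap f i (sval (cid (gs i w))).
have hP i v : h i (rmap g i v) = rmap f i v.
  rewrite /h; case: cid => u /= gu; apply/subr0_eq; rewrite -linearB.
  by apply: gf; rewrite linearB gu subrr.
have hl i : linear (h i).
  move=> a u v; have [u' <-] := gs i u; have [v' <-] := gs i v.
  by rewrite -linearP !hP linearP.
pose hL i : {linear space W i -> space X i} :=
  HB.pack (h i) (GRing.isLinear.Build k _ _ _ (h i) (hl i)).
have hE e w : hL (qhead e) (arrow W e w) = arrow X e (hL (qtail e) w).
  by have [w' <-] := gs _ w; rewrite /= -rmapE !hP rmapE.
by exists (RepHom hE); apply: rep_hom_ext => i v /=; rewrite hP.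
Qed.

Definition rep_iso V W : Prop := exists (f : rep_hom V W) (g : rep_hom W V),
  rep_comp g f = rep_id V /\ rep_comp f g = rep_id W.

Lemma same_image_iso U V W (f : rep_hom U W) (g : rep_hom V W) :
  rep_inj f -> rep_inj g -> im_sub f g -> im_sub g f -> rep_iso U V.
Proof.
move=> fi gi fg gf.
have [h hE] := factor_inj gi fg; have [h' hE'] := factor_inj fi gf.
exists h, h'; split; apply: rep_hom_ext => i u /=.
  by apply: (rep_injP fi); rewrite (rep_compE hE') (rep_compE hE).
by apply: (rep_injP gi); rewrite (rep_compE hE) (rep_compE hE').
Qed.

End Modules.

(** * Finitely generated subrepresentations of free representations are free *)

Section WeakAlgorithm.
Variables (k : fieldType) (Q : quiver).
Hypothesis lfQ : locally_finite Q.
Local Notation E := {classic (edge Q)}.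
Local Notation freeRep := (freeRep k).
Local Notation gen := (gen k).

Definition deg (J : finType) (s : J -> vertex Q) i (f : space (freeRep s) i) : nat :=
  let ex : exists d, `[< deg_le d f >] :=
    let: ex_intro d fd := deg_exists f in ex_intro _ d (asboolT fd) in ex_minn ex.

Lemma degP (J : finType) (s : J -> vertex Q) i (f : space (freeRep s) i) n :
  deg_le n f <-> (deg f <= n)%N.
Proof.
rewrite /deg; case: ex_minnP => m /asboolP fm mmin; split=> [fn|mn].
  by apply: mmin; apply/asboolP.
exact: fun_deg_leW fm.
Qed.

(** A homomorphism of free representations is injective when no image [x_j] of a
    generator can be lowered in degree by subtracting elements generated by the
    others. The weights [d j] grade the source so that [psi] is filtered, and
    the claim is that it is strict: if [psi a] has degree lower than expected,
    so has [a]. Otherwise look at the constant coefficients of [a]: those with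
    [d j] maximal vanish, or [x_j] could be lowered; the other ones do not
    affect the claim, and the rest of [a] is handled by removing last edges,
    which commutes with [psi]. *)
Lemma reduced_inj (J K : finType) (t : J -> vertex Q) (s : K -> vertex Q)
    (psi : rep_hom (freeRep t) (freeRep s)) (d : J -> nat) :
  (forall j, 0 < d j)%N ->
  (forall j, deg_le (d j) (rmap psi (t j) (gen t j))) ->
  (forall j (b : space (freeRep t) (t j)) n, (forall p, coef b j p = 0) ->
     deg_le n (rmap psi (t j) (gen t j) - rmap psi (t j) b) -> (d j <= n)%N) ->
  rep_inj psi.
Proof.
move=> d_gt0 dP red.
(* a constant term at a generator of maximal weight would give a reduction of it *)
have const n i (a : space (freeRep t) i) :
    (forall j p, coef a j p != 0 -> (size p + d j <= n.+1)%N) ->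
    deg_le n (rmap psi i a) ->
    (forall j, coef a j [::] != 0 -> (d j <= n)%N).
  move=> aS an j aj0; have /= := aS j [::] aj0.
  rewrite add0n leq_eqVlt ltnS => /predU1P[dj|//].
  have ti : t j = i := coef_route aj0.
  case: _ / ti in a aS an aj0 *.
  apply: (red j (gen t j - (coef a j [::])^-1 *: a)) => [[|e p]|].
  - by rewrite coefB coefZ coef_genE eqxx/= mulVf// subrr.
  - rewrite coefB coefZ coef_genE andbF sub0r.
    have [->|/aS] := eqVneq (coef a j (e :: p)) 0; first by rewrite mulr0 oppr0.
    by rewrite dj -[X in (_ <= X)%N]add0n leq_add2r.
  by rewrite linearB linearZ opprB addrC subrK -[X in deg_le _ X]addr0; apply: deg_leP.
have strict n i (a : space (freeRep t) i) :
    (forall j p, coef a j p != 0 -> (size p + d j <= n.+1)%N) ->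
    deg_le n (rmap psi i a) ->
    (forall j p, coef a j p != 0 -> (size p + d j <= n)%N).
  elim: n i a => [|n IHn] i a aS an j p ajp; have := aS j p ajp.
    case: p => [|e p] in ajp *; first by move=> _; apply: const aS an j ajp.
    by rewrite addSn ltnS leqn0 addn_eq0 (eqn0Ngt (d j)) d_gt0 andbF.
  case: p => [|e p] in ajp *; first by move=> _; apply: const aS an j ajp.
  move=> _; have [ei _] := coef_route ajp.
  apply: (IHn _ (del e a)) => [j' p' /aS//||//].
  have -> : rmap psi (qtail e) (del e a) = - 1 *: (\sum_j coef a j [::] *:
      del e (vcast i (rmap psi (t j) (gen t j)))) + del e (rmap psi i a).
    by rewrite (del_hom lfQ) scaleN1r addKr.
  apply: deg_leP; last exact: deg_le_del.
  elim/big_rec: _ => [|j' f _ fn]; first by move=> ? ?.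
  have [->|/(const _ _ _ aS an) dj'] := eqVneq (coef a j' [::]) 0.
    by rewrite scale0r add0r.
  apply: deg_leP => //; apply: deg_le_del.
  have [ti|nti] := pselect (t j' = i); last by rewrite vcast_neq// => ? ?.
  by case: _ / ti; rewrite vcast_id; exact: fun_deg_leW dj' (dP j').
(* the weights are positive, so strictness for all degrees forces [a = 0] *)
move=> i a a0.
have [m am] := deg_exists a.
pose N := (m + \max_j d j)%N.
have aN j p : coef a j p != 0 -> (size p + d j <= N)%N.
  move=> ajp; apply: leq_add; last exact: (leq_bigmax j).
  by rewrite leqNgt; apply: contra ajp => /ltnW mp; apply/eqP/am.
elim: N aN => [|N IHN] aN; last by apply: IHN; apply: strict aN _; rewrite a0.
apply: coef_ext => j p; rewrite coef0; have [//|/aN] := eqVneq (coef a j p) 0.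
by rewrite leqn0 addn_eq0 (eqn0Ngt (d j)) d_gt0 andbF.
Qed.

(** Among the homomorphisms with the same source and image as [phi], one with the
    least total degree of the images of the generators is injective after the
    generators it kills are removed: otherwise subtracting from one image an
    element generated by the others would lower the total degree. *)
Lemma image_free (J K : finType) (t : J -> vertex Q) (s : K -> vertex Q)
    (phi : rep_hom (freeRep t) (freeRep s)) :
  exists n (r : 'I_n -> vertex Q) (psi : rep_hom (freeRep r) (freeRep s)),
    [/\ rep_inj psi, im_sub psi phi & im_sub phi psi].
Proof.
pose total (f : rep_hom (freeRep t) (freeRep s)) :=
  (\sum_j deg (rmap f (t j) (gen t j)))%N.
pose P m := `[< exists2 f : rep_hom (freeRep t) (freeRep s),
  im_sub f phi /\ im_sub phi f & total f = m >].
have exP : exists m, P m.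
  by exists (total phi); apply/asboolP; exists phi => //; split=> i u; exists u.
case: (ex_minnP exP) => m /asboolP[f [fphi phif] fm] mmin.
pose A := [pred j | rmap f (t j) (gen t j) != 0].
pose r (a : 'I_#|A|) := t (enum_val a).
pose iota : rep_hom (freeRep r) (freeRep t) :=
  free_lift lfQ (fun a => gen t (enum_val a)).
pose psi := rep_comp f iota.
have psi_gen a : rmap psi (r a) (gen r a) = rmap f _ (gen t (enum_val a)).
  by rewrite -[LHS]/(rmap f _ (rmap iota _ _)) lift_gen.
have psif : im_sub psi f by move=> i u; exists (rmap iota i u).
have fpsi : im_sub f psi.
  have ex j : {w : space (freeRep r) (t j) | rmap psi (t j) w = rmap f _ (gen t j)}.
    apply: cid; have [fj0|fj] := eqVneq (rmap f _ (gen t j)) 0.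
      by exists 0; rewrite linear0 fj0.
    have jA : j \in A by [].
    rewrite -(enum_rankK_in jA jA).
    by exists (gen r (enum_rank_in jA j)); rewrite psi_gen.
  pose res : rep_hom (freeRep t) (freeRep r) := free_lift lfQ (fun j => sval (ex j)).
  have resE : rep_comp psi res = f.
    apply: (free_hom_ext lfQ) => j.
    by rewrite -[LHS]/(rmap psi _ (rmap res _ _)) lift_gen (svalP (ex j)).
  by move=> i u; exists (rmap res i u); rewrite (rep_compE resE).
exists #|A|, r, psi; split.
- apply: (reduced_inj (d := fun a => deg (rmap f _ (gen t (enum_val a))))).
  + move=> a; rewrite lt0n; apply/eqP => d0.
    have := enum_valP a; rewrite inE => /eqP; apply; apply: deg_le0.
    by apply/degP; rewrite d0.
  + by move=> a; rewrite psi_gen; apply/degP.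
  move=> a b n b0 xb; rewrite leqNgt; apply/negP => nd.
  pose j0 := enum_val a.
  (* the substitutions adding [c *: b] to the generator [j0]; as [j0] does not
     occur in [b], those for [c = -1] and [c = 1] are inverse to each other *)
  pose shift c : rep_hom (freeRep t) (freeRep t) := free_lift lfQ (fun j =>
    gen t j + c *: (if j == j0 then vcast (t j) (rmap iota _ b) else 0)).
  have shift_neq c j : j != j0 -> rmap (shift c) (t j) (gen t j) = gen t j.
    by move=> /negPf jj0; rewrite lift_gen jj0 scaler0 addr0.
  have shift_eq c : rmap (shift c) (t j0) (gen t j0) = gen t j0 + c *: rmap iota _ b.
    by rewrite lift_gen eqxx vcast_id.
  have shift_b c : rmap (shift c) _ (rmap iota _ b) = rmap iota _ b.
    rewrite -[LHS]/(rmap (rep_comp (shift c) iota) _ b).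
    apply: (free_hom_eq_on lfQ) => a'.
    have [->|aa'] := eqVneq a' a; first by left.
    right; rewrite -[LHS]/(rmap (shift c) _ (rmap iota _ _)) lift_gen.
    by apply: shift_neq; apply: contra aa' => /eqP/enum_val_inj ->.
  pose f' := rep_comp f (shift (-1)).
  have f'K : rep_comp f' (shift 1) = f.
    apply: (free_hom_ext lfQ) => j.
    rewrite -[LHS]/(rmap f _ (rmap (shift (-1)) _ (rmap (shift 1) _ _))).
    have [->|jj0] := eqVneq j j0; last by rewrite !shift_neq.
    by rewrite shift_eq scale1r linearD/= shift_eq shift_b scaleN1r subrK.
  have : (m <= total f')%N.
    apply: mmin; apply/asboolP; exists f' => //; split=> i u; first exact: fphi.
    have [v <-] := phif i u; exists (rmap (shift 1) i v).
    by rewrite (rep_compE f'K).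
  have f'E j : rmap f' _ (gen t j) = rmap f _ (rmap (shift (-1)) _ (gen t j)) by [].
  apply/negP; rewrite -ltnNge -fm /total (bigD1 j0) // [X in (_ < X)%N](bigD1 j0) //.
  rewrite -addSn; apply: leq_add; last first.
    by apply: leq_sum => j; rewrite andTb => jj0; rewrite f'E shift_neq.
  apply: leq_ltn_trans nd; apply/degP.
  by rewrite f'E shift_eq scaleN1r linearB; move: xb; rewrite psi_gen.
- by move=> i u; have [v <-] := psif i u; exact: fphi.
by move=> i u; have [v <-] := phif i u; exact: fpsi.
Qed.

End WeakAlgorithm.

(** * Cokernels, products, and direct sums of free representations *)

Section Quotient.
Variables (k : fieldType) (V : lmodType k).

Record subspace := Subspace {
  sub_set :> V -> Prop;
  sub_set0 : sub_set 0;
  sub_setP : forall a u v, sub_set u -> sub_set v -> sub_set (a *: u + v) }.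

Variable U : subspace.

Lemma sub_setN u : U u -> U (- u).
Proof. by move=> Uu; rewrite -scaleN1r -[X in U X]addr0; apply: sub_setP => //; exact: sub_set0. Qed.
Lemma sub_setD u v : U u -> U v -> U (u + v).
Proof. by move=> Uu Uv; rewrite -[u]scale1r; exact: sub_setP. Qed.
Lemma sub_setZ a u : U u -> U (a *: u).
Proof. by move=> Uu; rewrite -[X in U X]addr0; apply: sub_setP => //; exact: sub_set0. Qed.

(** A representative of the coset of [x] that depends on the coset only. *)
Definition coset_repr (x : V) : V := xget 0 [set y | U (y - x)].

Lemma coset_reprP x : U (coset_repr x - x).
Proof.
rewrite /coset_repr; case: xgetP => [y _ //|/(_ x)]; case=> /=.
by rewrite subrr; exact: sub_set0.
Qed.

Lemma coset_repr_eq x y : U (x - y) -> coset_repr x = coset_repr y.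
Proof.
move=> Uxy; congr xget; apply/seteqP; split=> z /= Uz.
  by rewrite -(subrK x z) -addrA; exact: sub_setD.
by rewrite -(subrK y z) -addrA; apply: sub_setD => //; rewrite -opprB; exact: sub_setN.
Qed.

(** The quotient by [U], realised on the chosen representatives of the cosets. *)
Record quot := Quot { qrep : V; qrepP : coset_repr qrep == qrep }.
HB.instance Definition _ := [isSub for qrep].
HB.instance Definition _ := [Choice of quot by <:].

Fact qpi_subproof x : coset_repr (coset_repr x) == coset_repr x.
Proof. by apply/eqP/coset_repr_eq/coset_reprP. Qed.
Definition qpi x := Quot (qpi_subproof x).

Lemma qpiK q : qpi (qrep q) = q.
Proof. by apply: val_inj; apply/eqP; exact: qrepP. Qed.

Lemma qpi_eq x y : U (x - y) -> qpi x = qpi y.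
Proof. by move=> Uxy; apply: val_inj; exact: coset_repr_eq. Qed.

Lemma qpi_eqP x y : qpi x = qpi y -> U (x - y).
Proof.
move=> /(congr1 qrep)/= xy; rewrite -(subrK (coset_repr x) x) -addrA.
apply: sub_setD; last by rewrite xy; exact: coset_reprP.
by rewrite -opprB; apply: sub_setN; exact: coset_reprP.
Qed.

Definition qadd p q := qpi (qrep p + qrep q).
Definition qopp p := qpi (- qrep p).
Definition qscale (a : k) p := qpi (a *: qrep p).

Lemma qpi_add x y : qadd (qpi x) (qpi y) = qpi (x + y).
Proof. by apply: qpi_eq; rewrite opprD addrACA; apply: sub_setD; exact: coset_reprP. Qed.
Lemma qpi_opp x : qopp (qpi x) = qpi (- x).
Proof. by apply: qpi_eq; rewrite -opprD; apply: sub_setN; exact: coset_reprP. Qed.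
Lemma qpi_scale a x : qscale a (qpi x) = qpi (a *: x).
Proof. by apply: qpi_eq; rewrite -scalerBr; apply: sub_setZ; exact: coset_reprP. Qed.

Fact qaddA : associative qadd.
Proof. by move=> p q r; rewrite -(qpiK p) -(qpiK q) -(qpiK r) !qpi_add addrA. Qed.
Fact qaddC : commutative qadd.
Proof. by move=> p q; rewrite -(qpiK p) -(qpiK q) !qpi_add addrC. Qed.
Fact qadd0 : left_id (qpi 0) qadd.
Proof. by move=> p; rewrite -(qpiK p) !qpi_add add0r. Qed.
Fact qaddN : left_inverse (qpi 0) qopp qadd.
Proof. by move=> p; rewrite -(qpiK p) qpi_opp qpi_add addNr. Qed.
HB.instance Definition _ := GRing.isZmodule.Build quot qaddA qaddC qadd0 qaddN.

Fact qscaleA a b p : qscale a (qscale b p) = qscale (a * b) p.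
Proof. by rewrite -(qpiK p) !qpi_scale scalerA. Qed.
Fact qscale1 : left_id 1 qscale.
Proof. by move=> p; rewrite -(qpiK p) !qpi_scale scale1r. Qed.
Fact qscaleDr : right_distributive qscale +%R.
Proof.
move=> a p q; rewrite -(qpiK p) -(qpiK q) -[_ + _]/(qadd _ _) -[RHS]/(qadd _ _).
by rewrite !(qpi_add, qpi_scale) scalerDr.
Qed.
Fact qscaleDl p : {morph qscale^~ p : a b / a + b}.
Proof.
move=> a b; rewrite -(qpiK p) -[RHS]/(qadd _ _).
by rewrite !(qpi_add, qpi_scale) scalerDl.
Qed.
HB.instance Definition _ := GRing.Zmodule_isLmodule.Build k quot
  qscaleA qscale1 qscaleDr qscaleDl.

Fact qpi_linear : linear qpi.
Proof. by move=> a x y; rewrite -qpi_add -qpi_scale. Qed.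
HB.instance Definition _ := GRing.isLinear.Build k V quot _ qpi qpi_linear.

Lemma qpi_eq0 x : qpi x = 0 <-> U x.
Proof. by rewrite -[X in _ <-> U X]subr0; split=> [/qpi_eqP|/qpi_eq]. Qed.

End Quotient.

Section Constructions.
Variables (k : fieldType) (Q : quiver).
Implicit Types U V W : rep k Q.

Section Cokernel.
Variables (V W : rep k Q) (f : rep_hom V W).

Definition im_set i (w : space W i) : Prop := exists v, rmap f i v = w.

Fact im_set0 i : im_set (0 : space W i).
Proof. by exists 0; rewrite linear0. Qed.
Fact im_setP i a (u v : space W i) : im_set u -> im_set v -> im_set (a *: u + v).
Proof. by move=> [x <-] [y <-]; exists (a *: x + y); rewrite linearP. Qed.

Definition im_subspace i : subspace (space W i) := Subspace (@im_set0 i) (@im_setP i).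

Definition coker_arrow e (q : quot (im_subspace (qtail e))) :
  quot (im_subspace (qhead e)) := qpi _ (arrow W e (qrep q)).

Fact coker_arrow_pi e w : coker_arrow (qpi _ w : quot (im_subspace (qtail e))) =
  qpi _ (arrow W e w).
Proof.
apply: qpi_eq; rewrite -linearB /=.
have [v <-] : im_subspace (qtail e) (qrep (qpi (im_subspace (qtail e)) w) - w) by exact: coset_reprP.
by exists (arrow V e v); rewrite rmapE.
Qed.

Fact coker_arrow_linear e : linear (@coker_arrow e).
Proof.
move=> a p q; rewrite -(qpiK p) -(qpiK q) -linearP !coker_arrow_pi.
by rewrite -linearP -linearP.
Qed.
HB.instance Definition _ e := GRing.isLinear.Build k _ _ _ _ (@coker_arrow_linear e).

Definition coker : rep k Q := Rep (space := fun i => quot (im_subspace i))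
  (fun e => coker_arrow (e := e)).

Definition coker_proj : rep_hom W coker :=
  @RepHom k Q W coker (fun i => qpi (im_subspace i))
    (fun e w => esym (coker_arrow_pi w)).

Lemma coker_exact : right_exact f coker_proj.
Proof.
split=> [i q|i w]; first by exists (qrep q); exact: qpiK.
exact: qpi_eq0.
Qed.

End Cokernel.

Section Product.
Variables V W : rep k Q.

Definition prod_arrow e (x : space V (qtail e) * space W (qtail e)) :
  space V (qhead e) * space W (qhead e) := (arrow V e x.1, arrow W e x.2).
Fact prod_arrow_linear e : linear (@prod_arrow e).
Proof. by move=> a x y; rewrite /prod_arrow !linearP. Qed.
HB.instance Definition _ e := GRing.isLinear.Build k _ _ _ _ (@prod_arrow_linear e).

Definition rep_prod : rep k Q := Rep (space := fun i => (space V i * space W i)%type)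
  (fun e => prod_arrow (e := e)).

Definition inl_fun i (v : space V i) : space rep_prod i := (v, 0).
Fact inl_linear i : linear (@inl_fun i).
Proof.
by move=> a u v; rewrite -[RHS]/(a *: u + v, a *: (0 : space W i) + 0) scaler0 addr0.
Qed.
HB.instance Definition _ i := GRing.isLinear.Build k _ _ _ _ (@inl_linear i).

Definition inr_fun i (w : space W i) : space rep_prod i := (0, w).
Fact inr_linear i : linear (@inr_fun i).
Proof.
by move=> a u v; rewrite -[RHS]/(a *: (0 : space V i) + 0, a *: u + v) scaler0 addr0.
Qed.
HB.instance Definition _ i := GRing.isLinear.Build k _ _ _ _ (@inr_linear i).

Fact inl_arrow e v : inl_fun (arrow V e v) = arrow rep_prod e (inl_fun v).
Proof. by rewrite /inl_fun /= /prod_arrow /= linear0. Qed.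
Fact inr_arrow e v : inr_fun (arrow W e v) = arrow rep_prod e (inr_fun v).
Proof. by rewrite /inr_fun /= /prod_arrow /= linear0. Qed.

Definition rep_inl : rep_hom V rep_prod := RepHom inl_arrow.
Definition rep_inr : rep_hom W rep_prod := RepHom inr_arrow.

Definition rep_fst : rep_hom rep_prod V :=
  @RepHom k Q rep_prod V (fun i => fst) (fun e x => erefl).
Definition rep_snd : rep_hom rep_prod W :=
  @RepHom k Q rep_prod W (fun i => snd) (fun e x => erefl).

End Product.

Hypothesis lfQ : locally_finite Q.
Local Notation freeRep := (freeRep k).
Local Notation gen := (gen k).

Section FreeSum.
Variables (J K : finType) (s : J -> vertex Q) (t : K -> vertex Q).

Definition sumv (x : J + K) : vertex Q :=
  match x with inl j => s j | inr j => t j end.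

Definition copair V (f : rep_hom (freeRep s) V) (g : rep_hom (freeRep t) V) :
    rep_hom (freeRep sumv) V :=
  free_lift lfQ (fun x : J + K => match x return space V (sumv x) with
    | inl j => rmap f (s j) (gen s j) | inr j => rmap g (t j) (gen t j) end).

Definition free_inl : rep_hom (freeRep s) (freeRep sumv) :=
  free_lift lfQ (fun j => gen sumv (inl j)).
Definition free_inr : rep_hom (freeRep t) (freeRep sumv) :=
  free_lift lfQ (fun j => gen sumv (inr j)).

Lemma copair_inl V (f : rep_hom (freeRep s) V) (g : rep_hom (freeRep t) V) :
  rep_comp (copair f g) free_inl = f.
Proof.
apply: (free_hom_ext lfQ) => j; rewrite -[LHS]/(rmap _ _ (rmap _ _ _)) lift_gen.
exact: (lift_gen lfQ _ (inl j)).
Qed.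

Lemma copair_inr V (f : rep_hom (freeRep s) V) (g : rep_hom (freeRep t) V) :
  rep_comp (copair f g) free_inr = g.
Proof.
apply: (free_hom_ext lfQ) => j; rewrite -[LHS]/(rmap _ _ (rmap _ _ _)) lift_gen.
exact: (lift_gen lfQ _ (inr j)).
Qed.

Lemma copair_ext V (f g : rep_hom (freeRep sumv) V) :
  rep_comp f free_inl = rep_comp g free_inl ->
  rep_comp f free_inr = rep_comp g free_inr -> f = g.
Proof.
move=> fgl fgr; apply: (free_hom_ext lfQ) => -[j|j].
  have := rep_compE fgl (gen s j).
  by rewrite -[rmap (rep_comp _ _) _ _]/(rmap _ _ (rmap _ _ _)) lift_gen.
have := rep_compE fgr (gen t j).
by rewrite -[rmap (rep_comp _ _) _ _]/(rmap _ _ (rmap _ _ _)) lift_gen.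
Qed.

End FreeSum.

End Constructions.

(** * Finitely presented representations *)

Section FinitelyPresented.
Variables (k : fieldType) (Q : quiver).
Hypotheses (lfQ : locally_finite Q) (no_path : no_infinite_path Q).
Implicit Types M N P V W : rep k Q.
Local Notation freeRep := (freeRep k).
Local Notation gen := (gen k).

Lemma rep_comp_surj V W M (g : rep_hom W M) (f : rep_hom V W) :
  rep_surj g -> rep_surj f -> rep_surj (rep_comp g f).
Proof. by move=> gs fs i m; have [w <-] := gs i m; have [v <-] := fs i w; exists v. Qed.

Lemma free_fin_supported (J : finType) (s : J -> vertex Q) : fin_supported (freeRep s).
Proof.
have ex a : {S : set (vertex Q) | [/\ finite_set S, S a &
    forall e, S (qtail e) -> S (qhead e)]}.
  exact/cid/finite_reach.
apply: (@sub_finite_set _ _ (\bigcup_(j in [set: J]) sval (ex (s j)))); last first.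
  by apply: bigcup_finite => // j _; case: (svalP (ex (s j))).
move=> i [f] /eqP fN0; have [j [p fjp]] : exists j p, coef f j p != 0.
  apply: contrapT => nf; apply: fN0; apply: coef_ext => j p; rewrite coef0.
  by apply/eqP; apply: contrapT => /negP fjp; apply: nf; exists j, p.
exists j => //; case: (svalP (ex (s j))) => _ Sj Scl.
have := coef_route fjp; elim: p i {f fN0 fjp} => [|e p IHp] i /= => [<-//|].
by move=> [<- /IHp]; exact: Scl.
Qed.

(** The subrepresentation generated by the generators contains all trivial paths,
    hence all paths, by induction on the length. *)
Lemma free_fg (J : finType) (s : J -> vertex Q) : finitely_generated (freeRep s).
Proof.
exists #|J|, (fun a => s (enum_val a)), (fun a => gen s (enum_val a)).
move=> U [U0 Ul Ua] Ug i f; have [d] := deg_exists f.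
have UD i' (u v : space (freeRep s) i') : U i' u -> U i' v -> U i' (u + v).
  by move=> Uu Uv; rewrite -[u]scale1r; exact: Ul.
have UZ i' a (u : space (freeRep s) i') : U i' u -> U i' (a *: u).
  by move=> Uu; rewrite -[X in U _ X]addr0; exact: Ul.
have Uc i' i'' (u : space (freeRep s) i') : U i' u -> U i'' (vcast i'' u).
  have [e|ne] := pselect (i' = i''); last by rewrite vcast_neq.
  by case: _ / e; rewrite vcast_id.
elim: d i f => [|d IHd] i f fd; first by rewrite (deg_le0 fd).
rewrite (free_decomp lfQ f); apply: (UD); first apply: (big_ind (U i)) => [|x y|j _].
- exact: U0.
- exact: UD.
- by apply/UZ/Uc; have := Ug (enum_rank j); rewrite enum_rankK.
apply: (big_ind (U i)) => [|x y|e _]; first exact: U0.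
  exact: UD.
by apply/Uc/Ua/IHd/deg_le_del.
Qed.

Lemma free_lift_surj (J : finType) (s : J -> vertex Q) V W (f : rep_hom V W)
    (g : rep_hom (freeRep s) W) :
  im_sub g f -> exists h : rep_hom (freeRep s) V, rep_comp f h = g.
Proof.
move=> gf; exists (free_lift lfQ (fun j => sval (cid (gf _ (gen s j))))).
apply: (free_hom_ext lfQ) => j; rewrite -[LHS]/(rmap _ _ (rmap _ _ _)) lift_gen.
exact: (svalP (cid (gf _ (gen s j)))).
Qed.

Lemma free_projective (J : finType) (s : J -> vertex Q) : projective_module (freeRep s).
Proof. by move=> V W f g fs; apply: free_lift_surj => i u; exact: fs. Qed.

Lemma free_in_Proj (J : finType) (s : J -> vertex Q) : in_Proj (freeRep s).
Proof. split; [exact: free_fin_supported|exact: free_fg|exact: free_projective]. Qed.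

Lemma im_subrep V W (f : rep_hom V W) : subrep (fun i w => exists v, rmap f i v = w).
Proof.
split=> [i|i a _ _ [u <-] [v <-]|e _ [v <-]]; first by exists 0; rewrite linear0.
  by exists (a *: u + v); rewrite linearP.
by exists (arrow V e v); rewrite rmapE.
Qed.

Lemma fg_free_surj V : finitely_generated V ->
  exists n (s : 'I_n -> vertex Q) (h : rep_hom (freeRep s) V), rep_surj h.
Proof.
move=> [n [s [v vP]]]; exists n, s, (free_lift lfQ v) => i w.
apply: (vP _ (im_subrep (free_lift lfQ v))) => j.
by exists (gen s j); rewrite lift_gen.
Qed.

(** A retract of a free representation is the image of an idempotent. *)
Lemma retract_free (J : finType) (s : J -> vertex Q) P
    (f : rep_hom P (freeRep s)) (h : rep_hom (freeRep s) P) :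
  rep_comp h f = rep_id P ->
  exists n (r : 'I_n -> vertex Q), rep_iso P (freeRep r).
Proof.
move=> hf; have [n [r [psi [psi_inj psi_sub sub_psi]]]] := image_free lfQ (rep_comp f h).
exists n, r; apply: (same_image_iso (rep_comp_id_inj hf) psi_inj).
  move=> i u; have [x xE] := sub_psi i (rmap f i u).
  by exists x; rewrite xE /= (rep_compE hf).
by move=> i u; have [v <-] := psi_sub i u; exists (rmap h i v).
Qed.

Lemma in_Proj_free P : in_Proj P -> exists n (r : 'I_n -> vertex Q), rep_iso P (freeRep r).
Proof.
move=> [_ /fg_free_surj[n [s [h hs]]] Pp].
have [f hf] := Pp _ _ _ (rep_id P) hs.
exact: retract_free hf.
Qed.

(** In a presentation [P -> P' -> M -> 0] by finitely generated projectives, [P']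
    is free, and so is the image of [P] in it. *)
Lemma resolution M : finitely_presented M ->
  exists n m (t : 'I_n -> vertex Q) (s : 'I_m -> vertex Q)
    (f : rep_hom (freeRep t) (freeRep s)) (g : rep_hom (freeRep s) M), exact_pair f g.
Proof.
move=> [P [P' [f [g [[_ Pfg _] P'P [gs fg]]]]]].
have [m [s [a [b [ba ab]]]]] := in_Proj_free P'P.
have [l [u [h hs]]] := fg_free_surj Pfg.
have [n [t [psi [psi_inj psi_sub sub_psi]]]] :=
  image_free lfQ (rep_comp a (rep_comp f h)).
exists n, m, t, s, psi, (rep_comp g b); split=> //; split=> [|i v].
  exact: rep_comp_surj gs (rep_comp_id_surj ba).
split=> [/fg[x fx]|[y <-]].
  have [z zx] := hs i x; have [y yz] := sub_psi i z; exists y.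
  by rewrite yz /= zx fx (rep_compE ab).
have [z <-] := psi_sub i y; rewrite /= (rep_compE ba) /=.
by apply/fg; exists (rmap h i z).
Qed.

Definition inR M := fin_supported M /\ finitely_presented M.

Lemma presentation_inR (J K : finType) (t : J -> vertex Q) (s : K -> vertex Q) M
    (f : rep_hom (freeRep t) (freeRep s)) (g : rep_hom (freeRep s) M) :
  right_exact f g -> inR M.
Proof.
move=> fg; split; last first.
  by exists (freeRep t), (freeRep s), f, g; split=> //; exact: free_in_Proj.
apply: sub_finite_set (free_fin_supported s) => i [v vN0].
have [gs _] := fg; have [x xv] := gs i v; exists x.
by apply: contra vN0 => /eqP x0; rewrite -xv x0 linear0.
Qed.

Lemma free_inR (J : finType) (s : J -> vertex Q) : inR (freeRep s).
Proof.
apply: (@presentation_inR _ _ _ _ _ (rep_zero (freeRep (fun x : void => match x with end)) _)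
  (rep_id _)); split=> [i v|i v /=]; first by exists v.
by split=> [->|[_ <-//]]; exists 0.
Qed.

(** If [F' -> F -> N -> 0] presents [N], the images in [N] of generators of [M]
    lift to [F], and adding these lifts to [F'] presents the cokernel. *)
Lemma coker_inR M N (f : rep_hom M N) : finitely_generated M -> inR N -> inR (coker f).
Proof.
move=> /fg_free_surj[l [u [h hs]]] [_ /resolution].
move=> [n [m [t [s [a [p [_ [ps ap]]]]]]]].
have [w wE] : exists w : rep_hom (freeRep u) (freeRep s), rep_comp p w = rep_comp f h.
  by apply: free_lift_surj => i x; exact: ps.
have [cs fc] := coker_exact f.
apply: (@presentation_inR _ _ _ _ _ (copair lfQ a w) (rep_comp (coker_proj f) p)).
split=> [|i x]; first exact: rep_comp_surj cs ps.
have inlE := rep_compE (copair_inl lfQ a w); have inrE := rep_compE (copair_inr lfQ a w).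
split=> [/fc[y yx]|[z <-]].
  have [z zy] := hs i y.
  have /ap[x' ax'] : rmap p i (x - rmap w i z) = 0.
    by rewrite linearB (rep_compE wE) /= zy yx subrr.
  exists (rmap (free_inl k lfQ t u) i x' + rmap (free_inr k lfQ t u) i z).
  by rewrite linearD inlE inrE ax' subrK.
suff z0 : rep_comp (rep_comp (coker_proj f) p) (copair lfQ a w) = rep_zero _ _.
  exact: (rep_compE z0).
apply: (@copair_ext _ _ lfQ).
  rewrite -rep_compA copair_inl; apply: rep_hom_ext => j y; apply/fc.
  by exists 0; rewrite linear0; apply/esym/ap; exists y.
rewrite -rep_compA copair_inr; apply: rep_hom_ext => j y; apply/fc.
by exists (rmap h j y); rewrite (rep_compE wE).
Qed.

Lemma inR_fg M : inR M -> finitely_generated M.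
Proof.
move=> [_ [P [P' [f [g [_ [_ [n [s [v vP]]] _] [gs _]]]]]]].
exists n, s, (fun j => rmap g (s j) (v j)) => U [U0 Ul Ua] Uv i w.
have [x <-] := gs i w.
apply: (vP (fun i x => U i (rmap g i x))) => //; split=> [j|j a y z|e y].
- by rewrite linear0.
- by rewrite linearP; exact: Ul.
by rewrite rmapE; exact: Ua.
Qed.

Lemma prod_inR M N : inR M -> inR N -> inR (rep_prod M N).
Proof.
move=> [_ /resolution[n [m [t [s [f [g [_ [gs fg]]]]]]]]].
move=> [_ /resolution[n' [m' [t' [s' [f' [g' [_ [g's fg']]]]]]]]].
pose G := copair lfQ (rep_comp (rep_inl M N) g) (rep_comp (rep_inr M N) g').
pose F := copair lfQ (rep_comp (free_inl k lfQ s s') f) (rep_comp (free_inr k lfQ s s') f').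
pose p1 := copair lfQ (rep_id (freeRep s)) (rep_zero (freeRep s') (freeRep s)).
pose p2 := copair lfQ (rep_zero (freeRep s) (freeRep s')) (rep_id (freeRep s')).
have p1l : rep_comp p1 _ = _ := copair_inl lfQ _ _.
have p1r : rep_comp p1 _ = _ := copair_inr lfQ _ _.
have p2l : rep_comp p2 _ = _ := copair_inl lfQ _ _.
have p2r : rep_comp p2 _ = _ := copair_inr lfQ _ _.
have split_id : rep_add (rep_comp (free_inl k lfQ s s') p1) (rep_comp (free_inr k lfQ s s') p2)
    = rep_id _.
  apply: (@copair_ext _ _ lfQ); apply: rep_hom_ext => i x /=.
    by rewrite (rep_compE p1l) (rep_compE p2l) /= linear0 addr0.
  by rewrite (rep_compE p1r) (rep_compE p2r) /= linear0 add0r.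
have xE i x : x = rmap (free_inl k lfQ s s') i (rmap p1 i x) +
    rmap (free_inr k lfQ s s') i (rmap p2 i x).
  by rewrite -[LHS]/(rmap (rep_id _) i x) -split_id.
have Gl := rep_compE (copair_inl lfQ _ _ : rep_comp G _ = _).
have Gr := rep_compE (copair_inr lfQ _ _ : rep_comp G _ = _).
have Fl := rep_compE (copair_inl lfQ _ _ : rep_comp F _ = _).
have Fr := rep_compE (copair_inr lfQ _ _ : rep_comp F _ = _).
have GE i x : rmap G i x = (rmap g i (rmap p1 i x), rmap g' i (rmap p2 i x)).
  rewrite {1}(xE i x) linearD Gl Gr; congr pair; first exact: addr0.
  exact: add0r.
apply: (@presentation_inR _ _ _ _ _ F G); split=> [i [y z]|i x].
  have [a ay] := gs i y; have [b bz] := g's i z.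
  exists (rmap (free_inl k lfQ s s') i a + rmap (free_inr k lfQ s s') i b).
  rewrite linearD Gl Gr /= ay bz; congr pair; first exact: addr0.
  exact: add0r.
rewrite GE; split=> [[/fg[y fy] /fg'[z fz]]|[y <-]].
  exists (rmap (free_inl k lfQ t t') i y + rmap (free_inr k lfQ t t') i z).
  by rewrite linearD Fl Fr /= fy fz -xE.
suff z0 : rep_comp G F = rep_zero _ _ by rewrite -GE (rep_compE z0).
apply: (@copair_ext _ _ lfQ).
  rewrite -rep_compA copair_inl; apply: rep_hom_ext => j z /=.
  rewrite Gl /= (_ : rmap g j _ = 0) ?linear0//; last by apply/fg; exists z.
rewrite -rep_compA copair_inr; apply: rep_hom_ext => j z /=.
by rewrite Gr /= (_ : rmap g' j _ = 0) ?linear0//; last by apply/fg'; exists z.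
Qed.

End FinitelyPresented.

(** * The category of finitely presented representations *)

Section CategoryR.
Variables (k : fieldType) (Q : quiver).
Hypotheses (lfQ : locally_finite Q) (no_path : no_infinite_path Q).
Local Notation freeRep := (freeRep k).
Local Notation gen := (gen k).
Local Notation R := (Rcat k Q).
Local Notation L := (Rlin k Q).

Definition Robj M (MR : inR M) : R := exist _ M MR.
Definition freeR (J : finType) (s : J -> vertex Q) : R :=
  Robj (free_inR k lfQ no_path s).

(** The projection to the cokernel and the zero map agree on the image. *)
Lemma epi_surj (a b : R) (f : Mor a b) : epi f -> rep_surj (f : rep_hom (sval a) (sval b)).
Proof.
move=> ef; pose c : R := Robj (coker_inR lfQ no_path (f : rep_hom (sval a) (sval b))
  (inR_fg (svalP a)) (svalP b)).
have [_ fc] := coker_exact (f : rep_hom (sval a) (sval b)).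
have p0 : coker_proj f = rep_zero _ _.
  apply: (ef c); apply: rep_hom_ext => i x /=.
  by apply/(fc i); exists x.
by move=> i w; apply/fc; rewrite p0.
Qed.

Lemma surj_epi (a b : R) (f : Mor a b) : rep_surj (f : rep_hom (sval a) (sval b)) -> epi f.
Proof.
move=> fs c g h gf; apply: rep_hom_ext => i w; have [v <-] := fs i w.
exact: (rep_compE gf).
Qed.

Lemma free_projectiveR (J : finType) (s : J -> vertex Q) : projective (freeR s).
Proof. by move=> a b f g /epi_surj fs; exact: free_projective. Qed.

Lemma projectiveR_free (P : R) : projective P ->
  exists n (r : 'I_n -> vertex Q), rep_iso (sval P) (freeRep r).
Proof.
move=> Pp; have [n [s [h hs]]] := fg_free_surj lfQ (inR_fg (svalP P)).
have [f hf] := Pp (freeR s) P h (idmor P) (@surj_epi (freeR s) P h hs).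
exact: (retract_free lfQ hf).
Qed.

Lemma exact_short_exact (a b c : R) (f : Mor a b) (g : Mor b c) :
  exact_pair (f : rep_hom (sval a) (sval b)) (g : rep_hom (sval b) (sval c)) ->
  short_exact L f g.
Proof.
move=> [fi [gs fg]]; split; split.
- by apply: rep_hom_ext => i u; apply/fg; exists u.
- move=> d h gh; have [|h' h'E] := @factor_inj _ _ _ _ _ (h : rep_hom (sval d) _) f fi.
    by move=> i u; apply/fg; exact: (rep_compE gh).
  exists h'; split=> // h'' h''E; apply: rep_hom_ext => i u.
  by apply: (rep_injP fi); rewrite (rep_compE h'E) (rep_compE h''E).
- by apply: rep_hom_ext => i u; apply/fg; exists u.
move=> d h hf; have [|h' h'E] := factor_surj (f := h : rep_hom _ (sval d)) gs.
  by move=> i v /fg[u <-]; exact: (rep_compE hf).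
exists h'; split=> // h'' h''E; apply: rep_hom_ext => i w.
by have [v <-] := gs i w; rewrite (rep_compE h'E) (rep_compE h''E).
Qed.

(** Elements of [M] at [i] are the morphisms to [M] from the projective generated
    at [i], so kernels are computed pointwise. *)
Lemma short_exact_exact (a b c : R) (f : Mor a b) (g : Mor b c) :
  short_exact L f g ->
  exact_pair (f : rep_hom (sval a) (sval b)) (g : rep_hom (sval b) (sval c)).
Proof.
move=> [[gf0 fker] [_ gcok]].
have gs : rep_surj (g : rep_hom (sval b) (sval c)).
  apply: epi_surj => d h h' hh'.
  have [|h0 [_ h0u]] := gcok d (h \oc g).
    rewrite -Defs.compA gf0; apply: rep_hom_ext => i u; exact: linear0.
  by rewrite -(h0u h)// -(h0u h').
pose pt (i : vertex Q) : R := freeR (fun _ : unit => i).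
pose at_ (M : R) i (v : space (sval M) i) : Mor (pt i) M := free_lift lfQ (fun _ : unit => v).
have at_gen (M : R) i (v : space (sval M) i) : rmap (at_ M i v) i (gen (fun _ => i) tt) = v.
  exact: (lift_gen lfQ (fun _ : unit => v) tt).
split; [move=> i u fu|split=> // i v; split=> [gv|[u <-]]].
- have f0 : f \oc at_ a i u = hzero L (pt i) b.
    by apply: (free_hom_ext lfQ) => -[]; rewrite /= at_gen.
  have [|h0 [_ h0u]] := fker _ (hzero L (pt i) b).
    by apply: rep_hom_ext => j x; exact: linear0.
  rewrite -(at_gen a i u) -(h0u _ f0) (h0u (hzero L (pt i) a))//.
  by apply: rep_hom_ext => j x; exact: linear0.
- have [|h [fh _]] := fker _ (at_ b i v).
    by apply: (free_hom_ext lfQ) => -[]; rewrite /= at_gen.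
  by exists (rmap h i (gen (fun _ => i) tt)); rewrite (rep_compE fh) at_gen.
exact: (rep_compE gf0).
Qed.

Lemma resolutionR (M : R) : exists n m (t : 'I_n -> vertex Q) (s : 'I_m -> vertex Q)
  (f : Mor (freeR t) (freeR s)) (g : Mor (freeR s) M), short_exact L f g.
Proof.
have [_ /(resolution lfQ)[n [m [t [s [f [g fg]]]]]]] := svalP M.
by exists n, m, t, s, f, g; exact: exact_short_exact.
Qed.

Lemma gldimR : gldim_le L 1.
Proof.
move=> M; have [n [m [t [s [f [g fg]]]]]] := resolutionR M.
by exists (freeR t), (freeR s), f, g; split=> //; exact: free_projectiveR.
Qed.

Lemma enough_projectivesR : enough_projectives R.
Proof.
move=> M; have [n [m [t [s [f [g fg]]]]]] := resolutionR M.
exists (freeR s), g; split; first exact: free_projectiveR.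
by have [_ [gs _]] := short_exact_exact fg; exact: surj_epi.
Qed.

(** An object is determined by a homomorphism between free modules of finite
    rank, and these form a small set. *)
Lemma essentially_smallR : essentially_small R.
Proof.
pose S := {p : {n & 'I_n -> vertex Q} * {m & 'I_m -> vertex Q} &
  rep_hom (freeRep (projT2 p.1)) (freeRep (projT2 p.2))}.
pose F (x : S) : R := Robj (coker_inR lfQ no_path (projT2 x)
  (free_fg k lfQ _) (free_inR k lfQ no_path _)).
exists S, F => M; have [_ /(resolution lfQ)[n [m [t [s [f [g [fi [gs fg]]]]]]]]] := svalP M.
exists (existT _ (existT _ n t, existT _ m s) f : S).
have [cs fc] := coker_exact f.
have [|h hE] := factor_surj (f := coker_proj f) gs; first by move=> i v /fg/fc.
have [|h' h'E] := factor_surj (f := g) cs; first by move=> i v /fc/fg.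
exists h, h'; split; apply: rep_hom_ext => i x.
  by have [y <-] := gs i x; rewrite /= (rep_compE hE) (rep_compE h'E).
by have [y <-] := cs i x; rewrite /= (rep_compE h'E) (rep_compE hE).
Qed.

Lemma linearR : is_linear L.
Proof.
split.
- by move=> a b f g h; apply: rep_hom_ext => i v; exact: addrA.
- by move=> a b f g; apply: rep_hom_ext => i v; exact: addrC.
- by move=> a b f; apply: rep_hom_ext => i v; exact: add0r.
- move=> a b f; exists (hscale L (-1) f); apply: rep_hom_ext => i v /=.
  by rewrite scaleN1r addNr.
- by move=> a b x y f; apply: rep_hom_ext => i v; exact: scalerA.
- by move=> a b f; apply: rep_hom_ext => i v; exact: scale1r.
- by move=> a b x f g; apply: rep_hom_ext => i v; exact: scalerDr.
- by move=> a b x y f; apply: rep_hom_ext => i v; exact: scalerDl.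
- by move=> a b c g g' f; apply: rep_hom_ext.
- by move=> a b c g f f'; apply: rep_hom_ext => i v; exact: linearD.
- by move=> a b c x g f; apply: rep_hom_ext.
- by move=> a b c x g f; apply: rep_hom_ext => i v; exact: linearZ.
- exists (freeR (fun x : void => match x with end)).
  by apply: (free_hom_ext lfQ) => -[].
move=> a b; exists (Robj (prod_inR lfQ no_path (svalP a) (svalP b))).
exists (rep_inl (sval a) (sval b)), (rep_inr (sval a) (sval b)),
  (rep_fst (sval a) (sval b)), (rep_snd (sval a) (sval b)).
split; apply: rep_hom_ext => i //= -[u v] /=.
by congr pair; [exact: addr0|exact: add0r].
Qed.

End CategoryR.

(** * Sizes of finite sets *)

Section FiniteSizes.

Definition size_of (T : choiceType) (A : set T) : nat := #|` fset_set A|.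

Lemma size_of_eq (T U : choiceType) (A : set T) (B : set U) :
  finite_set A -> finite_set B -> (A #= B)%card -> size_of A = size_of B.
Proof. by move=> fA fB /(fcard_eq fA fB). Qed.

Lemma eq_size_of (T U : choiceType) (A : set T) (B : set U) :
  finite_set A -> finite_set B -> size_of A = size_of B -> (A #= B)%card.
Proof. by move=> fA fB /(fcard_eq fA fB). Qed.

Lemma size_of_gt0 (T : choiceType) (A : set T) x :
  finite_set A -> A x -> (0 < size_of A)%N.
Proof.
move=> fA Ax; rewrite cardfs_gt0; apply/fset0Pn; exists x.
by rewrite in_fset_set//; exact: mem_set.
Qed.

Lemma size_ofX (T U : choiceType) (A : set T) (B : set U) :
  finite_set A -> finite_set B -> size_of (A `*` B) = (size_of A * size_of B)%N.
Proof.
move=> fA fB; rewrite /size_of fset_setX// -(size_allpairs pair).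
apply/perm_size/uniq_perm.
- exact: fset_uniq.
- by apply: allpairs_uniq => [||[? ?] [? ?] _ _ [-> ->]//]; exact: fset_uniq.
move=> [x y]; rewrite in_fsetM /=; apply/andP/allpairsP => [[xA yB]|[[x' y'] [? ? [-> ->]]]//].
by exists (x, y).
Qed.

Lemma size_of_setT (T : finType) : size_of [set: T] = #|T|.
Proof.
rewrite /size_of [fset_set _](_ : _ = [fset x in T]%fset).
  by rewrite card_imfset//= cardE.
apply/fsetP => x; rewrite in_fset_set; last exact: finite_finset.
by apply/idP/imfsetP => _; [exists x|exact: mem_set].
Qed.

(** Counting in an extension: a set-theoretic section of [p] splits it. *)
Lemma size_of_extension (U' U W : zmodType) (A' : set U') (A : set U) (B : set W)
    (i : U' -> U) (p : U -> W) :
  (forall a b, p (a + b) = p a + p b) -> injective i ->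
  (forall a b, A a -> A b -> A (a + b)) -> (forall a, A a -> A (- a)) ->
  (forall u, A' u -> A (i u) /\ p (i u) = 0) ->
  (forall a, A a -> p a = 0 -> exists2 u, A' u & i u = a) ->
  (forall a, A a -> B (p a)) -> (forall b, B b -> exists2 a, A a & p a = b) ->
  finite_set A' -> finite_set B ->
  finite_set A /\ size_of A = (size_of A' * size_of B)%N.
Proof.
move=> pD i_inj AD AN iA kerA pA pS fA' fB.
pose s b := if pselect (exists2 a, A a & p a = b) is left e then s2val (cid2 e) else 0.
have sP b : B b -> A (s b) /\ p (s b) = b.
  move=> /pS ex; rewrite /s; case: pselect => // e.
  by split; [exact: (s2valP (cid2 e))|exact: (s2valP' (cid2 e))].
pose h (x : U' * W) := i x.1 + s x.2.
have hA : h @` (A' `*` B) = A.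
  apply/seteqP; split=> [_ [[u b] [/= /iA[iu _] /sP[sb _]] <-]|a Aa]; first exact: AD.
  have [sb psb] := sP _ (pA _ Aa).
  have [||u A'u iu] := kerA (a - s (p a)); first by apply: AD => //; exact: AN.
    by apply: (addIr (p (s (p a)))); rewrite -pD subrK psb add0r.
  by exists (u, p a); [split=> //=; exact: pA|rewrite /h /= iu subrK].
have h_inj : {in (A' `*` B) &, injective h}.
  move=> [u b] [u' b'] /set_mem[/= A'u Bb] /set_mem[/= A'u' Bb'] huv.
  have [_ pu] := iA _ A'u; have [_ pu'] := iA _ A'u'.
  have [_ pb] := sP _ Bb; have [_ pb'] := sP _ Bb'.
  have bb' : b = b' by have := congr1 p huv; rewrite /h /= !pD pu pu' pb pb' !add0r.
  by rewrite bb'; congr pair; apply: i_inj; move: huv; rewrite /h/= bb' => /addIr.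
have cA : (A #= A' `*` B)%card by rewrite -hA; exact: inj_card_eq.
have fAB : finite_set (A' `*` B) by exact: finite_setX.
have fA : finite_set A by rewrite (eq_finite_set cA).
by split=> //; rewrite -size_ofX//; exact: size_of_eq.
Qed.

End FiniteSizes.

(** * The index of a linear map with finite kernel and cokernel *)

Section Index.
Variable k : finFieldType.

Section Comb.
Variables (Y : lmodType k) (J : finType) (y : J -> Y).

Definition comb (c : {ffun J -> k}) : Y := \sum_j c j *: y j.

Lemma combD c c' : comb (c + c') = comb c + comb c'.
Proof. by rewrite /comb -big_split; apply: eq_bigr => j _; rewrite ffunE scalerDl. Qed.
Lemma combN c : comb (- c) = - comb c.
Proof. by rewrite /comb -sumrN; apply: eq_bigr => j _; rewrite ffunE scaleNr. Qed.
Lemma comb0 : comb 0 = 0.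
Proof. by rewrite /comb big1// => j _; rewrite ffunE scale0r. Qed.

End Comb.

Lemma comb_map (Y Z : lmodType k) (f : {linear Y -> Z}) (J : finType) (y : J -> Y) c :
  f (comb y c) = comb (fun j => f (y j)) c.
Proof. by rewrite /comb linear_sum; apply: eq_bigr => j _; rewrite linearZ. Qed.

Lemma eq_comb (Y : lmodType k) (J : finType) (y z : J -> Y) c : y =1 z ->
  comb y c = comb z c.
Proof. by move=> yz; apply: eq_bigr => j _; rewrite yz. Qed.

Section Completion.
Variables (X Y : lmodType k) (D : {linear X -> Y}).

Definition aug_ker (J : finType) (y : J -> Y) : set (X * {ffun J -> k}) :=
  [set u | D u.1 + comb y u.2 = 0].

Definition completes (J : finType) (y : J -> Y) : Prop :=
  (forall z, exists u : X * {ffun J -> k}, D u.1 + comb y u.2 = z) /\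
  finite_set (aug_ker y).

Definition finite_index : Prop := exists (J : finType) (y : J -> Y), completes y.

(** The [l]-adic valuation of the index [#|coker D| / #|ker D|]. Completing [D]
    to a surjection avoids the cokernel, and makes the additivity of the index
    elementary. *)
Definition log_index (l : nat) (z : int) : Prop :=
  exists (J : finType) (y : J -> Y), completes y /\
    z = (logn l (#|k| ^ #|J|))%:Z - (logn l (size_of (aug_ker y)))%:Z.

(** Two completions [y] and [y'] are compared through the kernel of their union. It
    is an extension of all values of the coefficients of [y'] by the kernel for
    [y], and conversely. *)
Definition aug_ker2 (J J' : finType) (y : J -> Y) (y' : J' -> Y) :
    set (X * ({ffun J -> k} * {ffun J' -> k})) :=
  [set u | D u.1 + comb y u.2.1 + comb y' u.2.2 = 0].

Lemma size_of_aug_ker2 (J J' : finType) (y : J -> Y) (y' : J' -> Y) : completes y ->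
  finite_set (aug_ker2 y y') /\
  size_of (aug_ker2 y y') = (size_of (aug_ker y) * #|k| ^ #|J'|)%N.
Proof.
move=> [ys yf]; rewrite -card_ffun -size_of_setT.
apply: (size_of_extension (i := fun u => (u.1, (u.2, 0)))
  (p := fun u => u.2.2)) => //=.
- by move=> [x c] [x' c'] [-> ->].
- move=> [x [c c']] [x1 [c1 c1']]; rewrite /aug_ker2 /= => ua ub; rewrite linearD !combD.
  by rewrite (addrACA (D x)) (addrACA (D x + _)) ua ub addr0.
- by move=> [x [c c']]; rewrite /aug_ker2 /= => ua; rewrite linearN !combN -!opprD ua oppr0.
- by move=> [x c]; rewrite /aug_ker /aug_ker2 /= comb0 addr0.
- move=> [x [c c']]; rewrite /aug_ker /aug_ker2 /= => + c'0; rewrite c'0 comb0 addr0.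
  by exists (x, c).
move=> c' _; have [[x c] /= xc] := ys (- comb y' c').
by exists (x, (c, c')) => //; rewrite /aug_ker2 /= xc addNr.
Qed.

Lemma aug_ker2C (J J' : finType) (y : J -> Y) (y' : J' -> Y) :
  finite_set (aug_ker2 y y') -> size_of (aug_ker2 y' y) = size_of (aug_ker2 y y').
Proof.
move=> f; pose sw (u : X * ({ffun J -> k} * {ffun J' -> k})) := (u.1, (u.2.2, u.2.1)).
have swE : sw @` aug_ker2 y y' = aug_ker2 y' y.
  apply/seteqP; split=> [_ [[x [c c']] /= u <-]|[x [c c']] /= u].
    by rewrite /aug_ker2 /= addrAC.
  by exists (x, (c', c)) => //; rewrite /aug_ker2 /= addrAC.
have e : (aug_ker2 y' y #= aug_ker2 y y')%card.
  by rewrite -swE; apply: inj_card_eq => -[x [c c']] [x1 [c1 c1']] _ _ [-> -> ->].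
by apply: size_of_eq => //; rewrite (eq_finite_set e).
Qed.

Lemma aug_ker_gt0 (J : finType) (y : J -> Y) : completes y -> (0 < size_of (aug_ker y))%N.
Proof.
by move=> [_ yf]; apply: (size_of_gt0 (x := 0)) => //; rewrite /aug_ker /= linear0 comb0 addr0.
Qed.

Lemma card_k_gt0 n : (0 < #|k| ^ n)%N.
Proof. by rewrite expn_gt0; apply/orP; left; apply/card_gt0P; exists 0. Qed.

Lemma log_index_unique l z z' : log_index l z -> log_index l z' -> z = z'.
Proof.
move=> [J [y [yc ->]]] [J' [y' [y'c ->]]].
have [f e] := size_of_aug_ker2 y' yc; have [_ e'] := size_of_aug_ker2 y y'c.
have := aug_ker2C f; rewrite e e' => /(congr1 (logn l)).
rewrite !lognM ?aug_ker_gt0 ?card_k_gt0// => E.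
apply/eqP; rewrite subr_eq addrAC eq_sym subr_eq -!PoszD eqz_nat.
by rewrite addnC -E addnC.
Qed.

Lemma finite_index_log l : finite_index -> exists z, log_index l z.
Proof. by move=> [J [y yc]]; eexists; exists J, y; split. Qed.

End Completion.

Section Additivity.
Variables (X' X X'' Y' Y Y'' : lmodType k).
Variables (D' : {linear X' -> Y'}) (D : {linear X -> Y}) (D'' : {linear X'' -> Y''}).
Variables (iX : {linear X' -> X}) (pX : {linear X -> X''}).
Variables (iY : {linear Y' -> Y}) (pY : {linear Y -> Y''}).
Hypotheses (Di : forall x, D (iX x) = iY (D' x)) (Dp : forall x, D'' (pX x) = pY (D x)).
Hypotheses (pXs : forall x, exists x', pX x' = x) (pYs : forall y, exists y', pY y' = y).
Hypotheses (exX : forall x, pX x = 0 <-> exists x', iX x' = x).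
Hypotheses (exY : forall y, pY y = 0 <-> exists y', iY y' = y).

(** A completion of [D] completes [D''] as well. An element of its kernel for [D'']
    lifts to [x], [c] such that [D x + comb y c] comes from [Y'], which the
    completion of [D'] then absorbs: the kernel is the image of a finite one. *)
Lemma finite_index_quotient : finite_index D' -> finite_index D -> finite_index D''.
Proof.
move=> [J' [y' [y's _]]] [J [y [ys yf]]].
exists J, (fun j => pY (y j)); split=> [z|].
  have [w <-] := pYs z; have [[x c] /= xc] := ys w.
  by exists (pX x, c); rewrite /= Dp -comb_map -linearD xc.
have [f _] := size_of_aug_ker2 (fun j => iY (y' j)) (conj ys yf).
apply: sub_finite_set (finite_image (fun u => (pX u.1, u.2.1)) f) => -[x'' c] /=.
have [x <-] := pXs x''; rewrite /aug_ker /= Dp -comb_map -linearD => /exY[w wE].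
have [[x' c'] /= x'c'] := y's w.
have pi0 : pX (iX x') = 0 by apply/exX; exists x'.
exists (x - iX x', (c, - c')) => /=; last by rewrite linearB pi0 subr0.
rewrite /aug_ker2 /= linearB Di combN -comb_map (addrAC (D x)).
by rewrite -(addrA (D x + _)) -opprD -linearD x'c' wE subrr.
Qed.

Hypotheses (iX_inj : forall x, iX x = 0 -> x = 0) (iY_inj : forall y, iY y = 0 -> y = 0).

(** Lifting the completion of [D''] and adding the image of that of [D'] completes
    [D]. As the completed maps are onto, their kernels form a short exact
    sequence. *)
Lemma log_indexD l z' z'' : log_index D' l z' -> log_index D'' l z'' ->
  log_index D l (z' + z'').
Proof.
move=> [J' [y' [y'c ->]]] [J'' [y'' [y''c ->]]].
have [y's y'f] := y'c; have [y''s y''f] := y''c.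
pose ly j := sval (cid (pYs (y'' j))).
have lyE c : pY (comb ly c) = comb y'' c.
  by rewrite comb_map; apply: eq_comb => j; exact: (svalP (cid (pYs (y'' j)))).
pose y (s : J' + J'') := match s with inl a => iY (y' a) | inr b => ly b end.
pose cl (c : {ffun J' + J'' -> k}) := [ffun a => c (inl a)].
pose cr (c : {ffun J' + J'' -> k}) := [ffun b => c (inr b)].
pose cc (c' : {ffun J' -> k}) (c'' : {ffun J'' -> k}) : {ffun J' + J'' -> k} :=
  [ffun s => match s with inl a => c' a | inr b => c'' b end].
have combE c : comb y c = iY (comb y' (cl c)) + comb ly (cr c).
  rewrite comb_map /comb big_sumType /=.
  by congr (_ + _); apply: eq_bigr => j _; rewrite ffunE.
have clcc c' c'' : cl (cc c' c'') = c' by apply/ffunP => a; rewrite !ffunE.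
have crcc c' c'' : cr (cc c' c'') = c'' by apply/ffunP => a; rewrite !ffunE.
have cck c : cc (cl c) (cr c) = c by apply/ffunP => -[a|a]; rewrite !ffunE.
have pi0 x : pX (iX x) = 0 by apply/exX; exists x.
have piY0 w : pY (iY w) = 0 by apply/exY; exists w.
have ys z : exists u : X * {ffun J' + J'' -> k}, D u.1 + comb y u.2 = z.
  have [[x'' c''] /= xc''] := y''s (pY z); have [x xx''] := pXs x''.
  have /exY[w wE] : pY (z - (D x + comb ly c'')) = 0.
    by rewrite linearB linearD -Dp xx'' lyE xc'' subrr.
  have [[x' c'] /= xc'] := y's w.
  exists (x + iX x', cc c' c''); rewrite /= combE clcc crcc linearD Di.
  by rewrite [iY _ + comb ly _]addrC addrACA -linearD xc' wE addrC subrK.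
have [fK sK] : finite_set (aug_ker D y) /\
    size_of (aug_ker D y) = (size_of (aug_ker D' y') * size_of (aug_ker D'' y''))%N.
  apply: (size_of_extension (i := fun u => (iX u.1, cc u.2 0))
    (p := fun u => (pX u.1, cr u.2))) => //.
  - move=> [x c] [x1 c1] /=; rewrite linearD; congr pair.
    by apply/ffunP => b; rewrite !ffunE.
  - move=> [x c] [x1 c1] [/= xx1 cc1]; congr pair.
      by apply/subr0_eq/iX_inj; rewrite linearB xx1 subrr.
    by rewrite -(clcc c 0) cc1 clcc.
  - move=> [x c] [x1 c1]; rewrite /aug_ker /= => u u1.
    by rewrite linearD combD addrACA u u1 addr0.
  - by move=> [x c]; rewrite /aug_ker /= => u; rewrite linearN combN -opprD u oppr0.
  - move=> [x c]; rewrite /aug_ker /= => u; rewrite pi0 crcc; split=> //.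
    by rewrite combE clcc crcc comb0 addr0 Di -linearD u linear0.
  - move=> [x c] /= u [/exX[x' x'x] c0]; exists (x', cl c); last first.
      by rewrite /= x'x -c0 cck.
    apply: iY_inj; move: u; rewrite /aug_ker /= combE c0 comb0 addr0 -x'x Di.
    by rewrite -linearD.
  - move=> [x c]; rewrite /aug_ker /= => u; rewrite Dp -lyE.
    by have := congr1 pY u; rewrite combE linear0 !linearD piY0 add0r.
  move=> [x'' c'']; rewrite {1}/aug_ker /= => u; have [x xx''] := pXs x''.
  have /exY[w wE] : pY (D x + comb ly c'') = 0 by rewrite linearD -Dp xx'' lyE.
  have [[x' c'] /= xc'] := y's w.
  exists (x - iX x', cc (- c') c''); last by rewrite /= linearB pi0 subr0 xx'' crcc.
  rewrite /aug_ker /= combE clcc crcc combN linearN linearB Di.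
  rewrite [- iY _ + comb ly _]addrC addrACA -opprD -linearD.
  by rewrite xc' wE subrr.
exists (J' + J'')%type, y; split=> //.
rewrite card_sum expnD sK !lognM ?card_k_gt0 ?aug_ker_gt0//.
by rewrite !PoszD opprD addrACA.
Qed.

End Additivity.
End Index.

(** * The index of a representation at a vertex *)

Section Tails.
Variables (k : fieldType) (Q : quiver).
Local Notation E := {classic (edge Q)}.
Implicit Types V W : rep k Q.

(** A product over a list, so that its properties follow by induction on the list. *)
Fixpoint tailsp V (l : seq E) : lmodType k :=
  if l is e :: l' then (space V (qtail e) * tailsp V l')%type else 'rV[k]_0.

Fixpoint insum V i (l : seq E) : tailsp V l -> space V i :=
  match l return tailsp V l -> space V i with
  | [::] => fun _ => 0
  | e :: l' => fun x => arr i x.1 + insum i x.2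
  end.

Fact insum_linear V i l : linear (@insum V i l).
Proof.
elim: l => [|e l IHl] a x y /=; first by rewrite scaler0 addr0.
by rewrite IHl linearP scalerDr addrACA.
Qed.
HB.instance Definition _ V i l := GRing.isLinear.Build k _ _ _ _ (@insum_linear V i l).

Fixpoint tailsmap V W (f : rep_hom V W) (l : seq E) : tailsp V l -> tailsp W l :=
  match l return tailsp V l -> tailsp W l with
  | [::] => fun _ => 0
  | e :: l' => fun x => (rmap f (qtail e) x.1, tailsmap f x.2)
  end.

Fact tailsmap_linear V W (f : rep_hom V W) l : linear (@tailsmap V W f l).
Proof.
elim: l => [|e l IHl] a x y /=; first by rewrite scaler0 addr0.
by rewrite IHl linearP.
Qed.
HB.instance Definition _ V W f l :=
  GRing.isLinear.Build k _ _ _ _ (@tailsmap_linear V W f l).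

Lemma insum_map V W (f : rep_hom V W) i l x :
  insum i (@tailsmap _ _ f l x) = rmap f i (insum i x).
Proof.
elim: l x => [|e l IHl] x /=; first by rewrite linear0.
by rewrite linearD IHl arr_map.
Qed.

Lemma tailsmap_surj V W (f : rep_hom V W) l : rep_surj f ->
  forall x, exists x', @tailsmap _ _ f l x' = x.
Proof.
move=> fs; elim: l => [|e l IHl] x /=; first by exists 0; exact: esym (thinmx0 x).
have [v vx] := fs _ x.1; have [y yx] := IHl x.2.
by exists (v, y); rewrite /= vx yx; case: x {vx yx}.
Qed.

Lemma tailsmap_inj V W (f : rep_hom V W) l : rep_inj f ->
  forall x, @tailsmap _ _ f l x = 0 -> x = 0.
Proof.
move=> fi; elim: l => [|e l IHl] x /=; first by move=> _; exact: thinmx0.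
by case: x => v y /= [/fi-> /IHl->].
Qed.

Lemma tailsmap_exact U V W (f : rep_hom U V) (g : rep_hom V W) l : right_exact f g ->
  forall x, @tailsmap _ _ g l x = 0 <-> exists x', @tailsmap _ _ f l x' = x.
Proof.
move=> [gs fg]; elim: l => [|e l IHl] x /=.
  by split=> // _; exists 0; exact: esym (thinmx0 x).
case: x => v y; split=> [[/fg[u uv] /IHl[y' yy']]|[[u y'] [uv yy']]].
  by exists (u, y'); rewrite /= uv yy'.
congr pair; first by apply/fg; exists u.
by apply/IHl; exists y'.
Qed.

Fixpoint tails_of V (v : forall e : edge Q, space V (qtail e)) (l : seq E) : tailsp V l :=
  match l return tailsp V l with
  | [::] => 0
  | e :: l' => (v e, tails_of v l')
  end.

Lemma insum_tails_of V v i l : insum i (@tails_of V v l) = \sum_(e <- l) arr i (v e).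
Proof. by elim: l => [|e l IHl] /=; rewrite ?big_nil// big_cons IHl. Qed.

End Tails.

Section FreeTails.
Variables (k : fieldType) (Q : quiver) (J : finType) (s : J -> vertex Q).
Local Notation E := {classic (edge Q)}.
Local Notation F := (freeRep k s).

Lemma coef_arr_nil i (e : E) (f : space F (qtail e)) j :
  coef (arr i f : space F i) j [::] = 0.
Proof.
have [ei|ei] := pselect (qhead e = i); first by rewrite coef_arr.
by rewrite /arr vcast_neq.
Qed.

Lemma coef_insum_nil i l (x : tailsp F l) j : coef (insum i x : space F i) j [::] = 0.
Proof. by elim: l x => [//|e l IHl] x /=; rewrite coefD IHl coef_arr_nil addr0. Qed.

Lemma coef_insum_cons i (l : seq E) (x : tailsp F l) j (e : E) p : e \notin l ->
  coef (insum i x : space F i) j (e :: p) = 0.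
Proof.
elim: l x => [//|e' l IHl] x /=; rewrite inE negb_or => /andP[ee' el].
rewrite coefD IHl// addr0; have [e'i|e'i] := pselect (qhead e' = i).
  by rewrite coef_arr// (negPf ee').
by rewrite /arr vcast_neq.
Qed.

Lemma free_insum_inj i (l : seq E) (x : tailsp F l) :
  uniq l -> (forall e, e \in l -> qhead e = i) ->
  insum i x = 0 -> x = 0.
Proof.
elim: l x => [|e l IHl] x /=; first by move=> _ _ _; exact: thinmx0.
case: x => f x /andP[el ul] hl /= fx.
have ei : qhead e = i by apply: hl; rewrite mem_head.
have f0 : f = 0.
  apply: coef_ext => j p; have := congr1 (fun z : space F i => coef z j (e :: p)) fx.
  by rewrite coefD coef_insum_cons// addr0 coef_arr// eqxx !coef0.
congr pair => //; apply: IHl => // [e' e'l|]; first by apply: hl; rewrite inE e'l orbT.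
by move: fx; rewrite f0 linear0 add0r.
Qed.

End FreeTails.

Section RepIndex.
Variables (k : finFieldType) (Q : quiver).
Hypothesis lfQ : locally_finite Q.
Local Notation E := {classic (edge Q)}.
Implicit Types V W : rep k Q.
Local Notation D V i := (@insum k Q V i (in_edges lfQ i)).

Definition rep_finite_index V i : Prop := finite_index (D V i).
Definition rep_index V i (l : nat) (z : int) : Prop := log_index (D V i) l z.

Lemma rep_finite_index_quotient U V W (f : rep_hom U V) (g : rep_hom V W) i :
  right_exact f g -> rep_finite_index U i -> rep_finite_index V i ->
  rep_finite_index W i.
Proof.
move=> fg; have [gs fgE] := fg.
apply: (@finite_index_quotient _ _ _ _ _ _ _ _ _ _
  (tailsmap f (l := in_edges lfQ i)) (tailsmap g (l := in_edges lfQ i)) (rmap f i) (rmap g i)).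
- exact: insum_map.
- exact: insum_map.
- exact: tailsmap_surj.
- exact: gs.
- exact: tailsmap_exact.
exact: fgE.
Qed.

Lemma rep_indexD U V W (f : rep_hom U V) (g : rep_hom V W) i l z' z'' :
  exact_pair f g -> rep_index U i l z' -> rep_index W i l z'' ->
  rep_index V i l (z' + z'').
Proof.
move=> [fi fg]; have [gs fgE] := fg.
apply: (@log_indexD _ _ _ _ _ _ _ _ _ _
  (tailsmap f (l := in_edges lfQ i)) (tailsmap g (l := in_edges lfQ i)) (rmap f i) (rmap g i)).
- exact: insum_map.
- exact: insum_map.
- exact: tailsmap_surj.
- exact: gs.
- exact: tailsmap_exact.
- exact: fgE.
- exact: tailsmap_inj.
exact: fi.
Qed.

(** Every element of a free module is uniquely the sum of a combination of the
    generators and of images of edges. *)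
Lemma free_completes (J : finType) (s : J -> vertex Q) i :
  let A := [pred j | `[< s j = i >]] in
  let y (a : 'I_#|A|) := vcast i (gen k s (enum_val a)) in
  completes (D (freeRep k s) i) y /\ aug_ker (D (freeRep k s) i) y = [set 0].
Proof.
move=> A y.
have combE (c : {ffun 'I_#|A| -> k}) a : coef (comb y c : space (freeRep k s) i)
    (enum_val a) [::] = c a.
  rewrite coef_sum (bigD1 a)//= big1 ?addr0 => [|b ba]; rewrite coefZ coef_gen.
    by have := enum_valP a; rewrite inE => ->; rewrite eqxx mulr1.
  by rewrite (inj_eq enum_val_inj) eq_sym (negPf ba) andbF mulr0.
have ker0 : aug_ker (D (freeRep k s) i) y = [set 0].
  apply/seteqP; split=> [[x c]|_ ->]; rewrite /aug_ker /=; last first.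
    by rewrite linear0 comb0 addr0.
  move=> xc; have c0 : c = 0.
    apply/ffunP => a; rewrite ffunE -combE; have := congr1
      (fun z : space (freeRep k s) i => coef z (enum_val a) [::]) xc.
    by rewrite coefD coef_insum_nil add0r coef0.
  congr pair => //; apply: (free_insum_inj (i := i) (in_edges_uniq lfQ i)) => [e|].
    by rewrite mem_in_edges => /asboolP.
  by move: xc; rewrite c0 comb0 addr0.
split=> //; split; last by rewrite ker0; exact: finite_set1.
move=> f; exists (tails_of (fun e => del e f : space (freeRep k s) (qtail e)) _,
  [ffun a => coef f (enum_val a) [::]]).
rewrite /= insum_tails_of [RHS](free_decomp lfQ f) addrC; congr (_ + _).
rewrite (bigID (fun j => j \in A))/= [X in _ = _ + X]big1 ?addr0 => [|j jA]; last first.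
  rewrite vcast_neq ?scaler0// => sj; move: jA.
  by rewrite inE /= asboolT.
by rewrite big_enum_val; apply: eq_bigr => a _; rewrite ffunE.
Qed.

Lemma free_index (J : finType) (s : J -> vertex Q) i l :
  rep_index (freeRep k s) i l (#|[pred j | `[< s j = i >]]| * logn l #|k|)%N.
Proof.
have [yc y0] := free_completes s i; do 2!eexists; split; first exact: yc.
by rewrite y0 /size_of fset_set1 cardfs1 logn1 subr0 card_ord lognX.
Qed.

Lemma free_finite_index (J : finType) (s : J -> vertex Q) i :
  rep_finite_index (freeRep k s) i.
Proof. by have [yc _] := free_completes s i; do 2!eexists; exact: yc. Qed.

Lemma tailsp_finite V : (forall i, finite_set [set: space V i]) ->
  forall l : seq E, finite_set [set: tailsp V l] /\
    forall p, logn p (size_of [set: tailsp V l]) =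
      (\sum_(e <- l) logn p (size_of [set: space V (qtail e)]))%N.
Proof.
move=> fV; elim=> [|e l [fl lE]] /=.
  have -> : [set: 'rV[k]_0] = [set 0].
    by apply/seteqP; split=> x //= _; exact: thinmx0.
  by split=> [|p]; [exact: finite_set1|rewrite big_nil /size_of fset_set1 cardfs1 logn1].
rewrite -setXTT; split=> [|p]; first exact: finite_setX.
have fe : finite_set [set: space V (qtail e)] := fV _.
rewrite (size_ofX fe fl) lognM ?lE ?big_cons//.
  exact: (size_of_gt0 (x := 0)).
exact: (size_of_gt0 (x := 0)).
Qed.

(** All elements of the finite space [V i] are adjoined to make the map onto; its
    kernel is then counted by the source and the target. *)
Lemma finite_rep_index V i l : (forall i, finite_set [set: space V i]) ->
  rep_index V i l ((logn l (size_of [set: space V i]))%:Z -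
    (\sum_(e <- in_edges lfQ i) logn l (size_of [set: space V (qtail e)]))%N%:Z).
Proof.
move=> fV; have [fl lE] := tailsp_finite fV (in_edges lfQ i).
have fVi : finite_set [set: space V i] := fV i.
pose J : finType := fset_set [set: space V i]; pose y (j : J) : space V i := val j.
have ys z : exists c : {ffun J -> k}, comb y c = z.
  have zJ : z \in fset_set [set: space V i] by rewrite (in_fset_set fVi); exact: mem_set.
  exists [ffun j => (j == FSetSub zJ)%:R]; rewrite /comb (bigD1 (FSetSub zJ))//= big1.
    by rewrite ffunE eqxx scale1r addr0.
  by move=> j /negPf jz; rewrite ffunE jz scale0r.
have fXC : finite_set [set: tailsp V (in_edges lfQ i) * {ffun J -> k}].
  by rewrite -setXTT; exact: finite_setX.
have fK : finite_set (aug_ker (D V i) y) by exact: sub_finite_set fXC.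
have yc : completes (D V i) y.
  by split=> // z; have [c cz] := ys z; exists (0, c); rewrite /= linear0 add0r.
have [_ E] : finite_set [set: tailsp V (in_edges lfQ i) * {ffun J -> k}] /\
    size_of [set: tailsp V (in_edges lfQ i) * {ffun J -> k}] =
    (size_of (aug_ker (D V i) y) * size_of [set: space V i])%N.
  apply: (size_of_extension (i := id) (p := fun u => D V i u.1 + comb y u.2)) => //.
  - by move=> [x c] [x' c'] /=; rewrite linearD combD addrACA.
  - by move=> u _ u0; exists u.
  by move=> z _; have [u uz] := yc.1 z; exists u.
exists J, y; split=> //; rewrite -lE; apply/eqP.
rewrite subr_eq addrAC eq_sym subr_eq -!PoszD eqz_nat addnC.
have gt0 (T : zmodType) : finite_set [set: T] -> (0 < size_of [set: T])%N.
  by move=> fT; exact: (size_of_gt0 (x := 0)).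
have := congr1 (logn l) E; rewrite -setXTT (size_ofX fl (finite_finset (T := {ffun J -> k}))).
rewrite (size_of_setT {ffun J -> k}) card_ffun.
by rewrite !lognM ?aug_ker_gt0 ?card_k_gt0 ?gt0// addnC => ->; rewrite addnC.
Qed.

End RepIndex.

(** * Isomorphisms between free representations *)

Section FreeMore.
Variables (k : fieldType) (Q : quiver).
Hypothesis lfQ : locally_finite Q.
Local Notation E := {classic (edge Q)}.
Local Notation gen := (gen k).
Local Notation freeRep := (freeRep k).

Lemma rep_iso_sym (V W : rep k Q) : rep_iso V W -> rep_iso W V.
Proof. by move=> [f [g [gf fg]]]; exists g, f. Qed.

Lemma rep_iso_trans (U V W : rep k Q) : rep_iso U V -> rep_iso V W -> rep_iso U W.
Proof.
move=> [f [g [gf fg]]] [f' [g' [gf' fg']]]; exists (rep_comp f' f), (rep_comp g g').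
split; apply: rep_hom_ext => i x /=.
  by rewrite (rep_compE gf') (rep_compE gf).
by rewrite (rep_compE fg) (rep_compE fg').
Qed.

Lemma split_exact (U V W : rep k Q) (f : rep_hom U V) (g : rep_hom V W)
    (r : rep_hom V U) (s : rep_hom W V) :
  rep_comp r f = rep_id U -> rep_comp g f = rep_zero U W -> rep_comp g s = rep_id W ->
  rep_add (rep_comp f r) (rep_comp s g) = rep_id V -> exact_pair f g.
Proof.
move=> rf gf gs fr; split; first exact: rep_comp_id_inj rf.
split=> [|i v]; first exact: rep_comp_id_surj gs.
split=> [gv|[u <-]]; last by rewrite (rep_compE gf).
exists (rmap r i v); rewrite -[RHS]/(rmap (rep_id V) i v) -fr /=.
by rewrite gv linear0 addr0.
Qed.

Lemma vcast_arr (V : rep k Q) e j (v : space V (qtail e)) :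
  vcast j (arr (qhead e) v) = arr j v.
Proof. exact: vcast_trans. Qed.

Lemma free_reindex (J K : finType) (s : J -> vertex Q) (t : K -> vertex Q)
    (f : J -> K) (g : K -> J) :
  cancel f g -> cancel g f -> (forall j, t (f j) = s j) ->
  rep_iso (freeRep s) (freeRep t).
Proof.
move=> fK gK tf.
have sg j : s (g j) = t j by rewrite -tf gK.
have castE (H : finType) (u : H -> vertex Q) a b i : a = b ->
    vcast i (gen u a) = vcast i (gen u b) :> space (freeRep u) i by move=> ->.
exists (free_lift lfQ (fun j => vcast (s j) (gen t (f j)))).
exists (free_lift lfQ (fun j => vcast (t j) (gen s (g j)))).
split; apply: (free_hom_ext lfQ) => j;
  rewrite -[LHS]/(rmap _ _ (rmap _ _ _)) lift_gen (vcast_map (rmap _)) lift_gen.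
  by rewrite vcast_trans// (castE _ _ _ _ _ (fK j)) vcast_id.
by rewrite vcast_trans// (castE _ _ _ _ _ (gK j)) vcast_id.
Qed.

End FreeMore.

(** * The resolution of the simple representation at a vertex *)

Section SimpleResolution.
Variables (k : fieldType) (Q : quiver).
Hypotheses (lfQ : locally_finite Q) (no_path : no_infinite_path Q).
Local Notation E := {classic (edge Q)}.
Local Notation gen := (gen k).
Local Notation freeRep := (freeRep k).
Variable i0 : vertex Q.

(** Row vectors of length 1 or 0 give the simple at [i0] without transport along
    [j = i0]. *)
Definition simple_space j : lmodType k := 'rV[k]_(`[< j = i0 >] : bool).
Definition simple : rep k Q := Rep (space := simple_space) (fun e => \0).

Definition simple_top : space simple i0 := const_mx 1.

Lemma simple_space_eq0 j (w : space simple j) : j <> i0 -> w = 0.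
Proof.
have gen_b (b : bool) (x : 'rV[k]_b) : ~~ b -> x = 0.
  by case: b x => // x _; exact: thinmx0.
by move=> ji; apply: gen_b; rewrite asboolF.
Qed.

Lemma simple_top_spans (w : space simple i0) : exists a, a *: simple_top = w.
Proof.
have gen_b (b : bool) (x : 'rV[k]_b) : b -> exists a, a *: const_mx 1 = x.
  case: b x => // x _; exists (x 0 0); apply/rowP => a.
  by rewrite !mxE mulr1 (ord1 a).
by apply: gen_b; apply/asboolP.
Qed.

Lemma simple_top_free a : a *: simple_top = 0 -> a = 0.
Proof.
have gen_b (b : bool) : b -> a *: (const_mx 1 : 'rV[k]_b) = 0 -> a = 0.
  by case: b => // _ /rowP/(_ 0); rewrite !mxE mulr1.
by apply: gen_b; apply/asboolP.
Qed.

Local Notation pt := (freeRep (fun _ : unit => i0)).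

Definition to_simple : rep_hom pt simple := free_lift lfQ (fun _ => simple_top).

Lemma to_simpleE j x : rmap to_simple j x = coef x tt [::] *: vcast j simple_top.
Proof.
rewrite (free_hom_decomp lfQ) [X in _ + X]big1 ?addr0 => [|e _]; last first.
  by rewrite /arr /= linear0.
rewrite (bigD1 tt)//= [X in _ + X]big1 ?addr0 => [|[]//].
by rewrite (lift_gen lfQ (fun _ => simple_top) tt).
Qed.

Lemma to_simple_surj : rep_surj to_simple.
Proof.
move=> j w; have [ji|ji] := pselect (i0 = j); last first.
  by exists 0; rewrite linear0; apply/esym/simple_space_eq0 => /esym.
case: _ / ji w => w; have [a <-] := simple_top_spans w.
by exists (a *: gen _ tt); rewrite linearZ/= (lift_gen lfQ (fun _ => simple_top) tt).
Qed.

Lemma to_simple_eq0 j x : rmap to_simple j x = 0 <-> coef x tt [::] = 0.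
Proof.
rewrite to_simpleE; split=> [|->]; last by rewrite scale0r.
have [->//|/coef_route/= ij] := eqVneq (coef x tt [::]) 0.
by case: _ / ij in x *; rewrite vcast_id => /simple_top_free.
Qed.

Local Notation out := (out_edges lfQ i0).

Definition out_edge (a : 'I_(size out)) : E := tnth (in_tuple out) a.

Lemma out_edge_tail a : qtail (out_edge a) = i0.
Proof. by apply/asboolP; rewrite -(mem_out_edges lfQ) mem_tnth. Qed.

Lemma out_edge_inj : injective out_edge.
Proof. by apply/tuple_uniqP; exact: out_edges_uniq. Qed.

Local Notation out_head := (fun a => qhead (out_edge a)).

(** The nontrivial paths from [i0] span a free representation, generated at the
    heads of the edges starting at [i0]: remove the first edge of each path. *)
Definition out_map : rep_hom (freeRep out_head) pt :=
  free_lift lfQ (fun a => @arr _ _ pt (out_edge a) _ (vcast (qtail (out_edge a)) (gen _ tt))).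

Lemma out_map_nil j x : coef (rmap out_map j x) tt [::] = 0.
Proof.
apply/to_simple_eq0; rewrite -[LHS]/(rmap (rep_comp to_simple out_map) j x).
suff -> : rep_comp to_simple out_map = rep_zero _ _ by [].
apply: (free_hom_ext lfQ) => a; rewrite -[LHS]/(rmap _ _ (rmap _ _ _)) lift_gen.
by rewrite arr_map /arr /= linear0.
Qed.

Lemma out_map_rcons j x p a :
  coef (rmap out_map j x) tt (rcons p (out_edge a)) = coef x a p.
Proof.
elim: p j x => [|e p IHp] j x; rewrite [rcons _ _]/= -coef_del (del_hom lfQ) coefD.
  rewrite out_map_nil addr0 coef_sum.
  have gen_coef b : coef x b [::] * coef (del (out_edge a) (@vcast k _ (space pt) _ j
      (rmap out_map _ (gen out_head b)))) tt [::] = (b == a)%:R * coef x b [::].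
    have [->|/coef_route bj] := eqVneq (coef x b [::]) 0; first by rewrite mul0r mulr0.
    have {}bj : out_head b = j := bj.
    rewrite mulrC lift_gen coef_del; congr (_ * _).
    rewrite vcast_arr coef_arr// (inj_eq out_edge_inj) eq_sym.
    by case: eqP => // _; rewrite coef_vcast ?out_edge_tail// coef_genE.
  rewrite (bigD1 a)//= coefZ gen_coef eqxx mul1r big1 ?addr0// => b /negPf ba.
  by rewrite coefZ gen_coef ba mul0r.
rewrite IHp coef_del coef_sum big1 ?add0r// => b _; rewrite coefZ lift_gen coef_del.
have [->|/coef_route bj] := eqVneq (coef x b [::]) 0; first by rewrite mul0r.
have {}bj : out_head b = j := bj.
rewrite vcast_arr coef_arr//; case: eqP => _; last by rewrite mulr0.
by rewrite coef_vcast ?out_edge_tail// coef_genE /nilp size_rcons mulr0.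
Qed.

Lemma route_rcons a p (e : edge Q) b :
  @route Q a (rcons p e) b -> a = qtail e /\ route (qhead e) p b.
Proof.
by elim: p b => [|e' p IHp] b /= [eb]; [case: _ / eb => ->|move=> /IHp[]].
Qed.

Lemma out_map_inj : rep_inj out_map.
Proof. by move=> j x x0; apply: coef_ext => a p; rewrite -out_map_rcons x0. Qed.

Lemma out_map_im j (y : space pt j) : coef y tt [::] = 0 -> exists x, rmap out_map j x = y.
Proof.
move=> y0; pose x0 (a : 'I_(size out)) p : k^o := coef y tt (rcons p (out_edge a)).
have x0P : x0 \in free_pred out_head j.
  apply/asboolP; split=> [a p /coef_route/route_rcons[]//|].
  have [d yd] := deg_exists y; exists d => a p dp; apply: yd.
  by rewrite size_rcons ltnW.
exists (FreeElt x0P); apply: coef_ext => -[] q.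
case/lastP: q => [|p e]; first by rewrite out_map_nil y0.
have [ei|ei] := pselect (qtail e = i0); last first.
  have nr (z : space pt j) : coef z tt (rcons p e) = 0.
    by have [//|/coef_route/route_rcons[/esym]] := eqVneq (coef z tt (rcons p e)) 0.
  by rewrite !nr.
have /tnthP[a ->] : e \in in_tuple out by rewrite mem_out_edges asboolT.
by rewrite -/(out_edge a) out_map_rcons.
Qed.

Lemma simple_exact : exact_pair out_map to_simple.
Proof.
split; first exact: out_map_inj.
split=> [|j x]; first exact: to_simple_surj.
rewrite to_simple_eq0; split=> [/out_map_im//|[y <-]].
exact: out_map_nil.
Qed.

Lemma simple_inR : inR simple.
Proof. by have [_ ex] := simple_exact; exact: (presentation_inR lfQ no_path ex). Qed.

End SimpleResolution.

(** * Grothendieck groups *)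

Section KTheory.
Variables (k : finFieldType) (Q : quiver).
Hypotheses (lfQ : locally_finite Q) (no_path : no_infinite_path Q).
Local Notation E := {classic (edge Q)}.
Local Notation gen := (gen k).
Local Notation freeRep := (freeRep k).
Local Notation R := (obj (Rcat k Q)).
Local Notation L := (Rlin k Q).
Local Notation freeR := (freeR k lfQ no_path).

Lemma finite_index_exists (M : R) i l : exists z, rep_index lfQ (sval M) i l z.
Proof.
have [_ /(resolution lfQ)[n [m [t [s [f [g [_ fg]]]]]]]] := svalP M.
apply: finite_index_log; apply: (rep_finite_index_quotient fg); exact: free_finite_index.
Qed.

(** The [l]-adic valuation of the index at [i], for any [l]: jointly these determine
    the index, and finite spaces are compared without dimensions. *)
Definition ind i l (M : R) : int := sval (cid (finite_index_exists M i l)).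

Lemma indP i l (M : R) z : rep_index lfQ (sval M) i l z -> ind i l M = z.
Proof. by move=> Mz; rewrite /ind; case: cid => z' /= Mz'; exact: log_index_unique Mz' Mz. Qed.

Lemma ind_rep i l (M : R) : rep_index lfQ (sval M) i l (ind i l M).
Proof. by rewrite /ind; case: cid. Qed.

Lemma ind_exact i l (e : exact_seq L) :
  ind i l (es_mid e) = ind i l (es_sub e) + ind i l (es_quo e).
Proof.
apply: indP; apply: rep_indexD (short_exact_exact lfQ no_path (es_exact e)) _ _;
  exact: ind_rep.
Qed.

(** The linear extension of [phi] to formal combinations of objects vanishes on
    the relators; it is computed by summing over the objects that occur. *)
Lemma Keq_additive (phi : R -> int) (A B : R) :
  (forall e : exact_seq L, phi (es_mid e) = phi (es_sub e) + phi (es_quo e)) ->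
  Keq L (Kclass int A) (Kclass int B) -> phi A = phi B.
Proof.
move=> phiD [n [c [e eq_e]]].
(* [rep a] is an index of the object [o a] that depends on the object only *)
pose o (a : bool + 'I_n * 'I_3) : R := match a with
  | inl b => if b then A else B
  | inr (i, j) => if j == ord0 then es_mid (e i) else
      if j == ord_max then es_sub (e i) else es_quo (e i) end.
pose rep a := [pick a' | `[< o a' = o a >]].
have rep_eq a a' : o a = o a' -> rep a = rep a'.
  by move=> aa'; apply: eq_pick => x; rewrite /= aa'.
pose S := [pred a | rep a == Some a].
have ev X : (exists a, o a = X) -> \sum_(a in S) phi (o a) * Kclass int X (o a) = phi X.
  move=> [b <-]; have [a0 oa0 ra0] : exists2 a0, o a0 = o b & rep a0 = Some a0.
    have : exists a, rep b = Some a /\ o a = o b.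
      rewrite /rep; case: pickP => [a /asboolP ab|/(_ b)]; first by exists a.
      by rewrite asboolT.
    by move=> [a [ra ab]]; exists a => //; rewrite -ra; exact: rep_eq.
  rewrite (bigD1 a0) ?inE ?ra0//= /Kclass asboolT ?oa0// mulr1.
  rewrite big1 ?addr0// => a; rewrite inE => /andP[/eqP ra aa0].
  rewrite asboolF ?mulr0// => ab; move/eqP: aa0; apply.
  by apply: Some_inj; rewrite -ra -ra0; apply: rep_eq; rewrite oa0.
have /eqP : \sum_(a in S) phi (o a) * (Kclass int A (o a) - Kclass int B (o a)) = 0.
  under eq_bigr => a _ do rewrite eq_e mulr_sumr.
  rewrite exchange_big big1//= => i _.
  under eq_bigr => a _ do rewrite mulrCA.
  rewrite -mulr_sumr; under eq_bigr => a _ do rewrite /relator !mulrBr.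
  rewrite !sumrB !ev; first by rewrite phiD [X in X - _ - _]addrC addrK subrr mulr0.
  - by exists (inr (i, inord 1)); rewrite /o /= -!val_eqE /= inordK.
  - by exists (inr (i, ord_max)).
  by exists (inr (i, ord0)).
under eq_bigr => a _ do rewrite mulrBr.
rewrite sumrB !ev ?subr_eq0; first by move/eqP.
  by exists (inl false).
by exists (inl true).
Qed.

Section Span.
Variables (T : Type) (g : T -> R -> rat).

Definition spans (x : R -> rat) : Prop :=
  exists n (c : 'I_n -> rat) (e : 'I_n -> T), forall N, x N = \sum_(i < n) c i * g (e i) N.

Lemma spans_gen t : spans (g t).
Proof. by exists 1%N, (fun _ => 1), (fun _ => t) => N; rewrite big_ord1 mul1r. Qed.

Lemma spansZ a x : spans x -> spans (fun N => a * x N).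
Proof.
move=> [n [c [e xE]]]; exists n, (fun i => a * c i), e => N.
by rewrite xE mulr_sumr; apply: eq_bigr => i _; rewrite mulrA.
Qed.

Lemma spansD x y : spans x -> spans y -> spans (fun N => x N + y N).
Proof.
move=> [n [c [e xE]]] [m [d [f yE]]].
exists (n + m)%N, (fun i => match fintype.split i with inl a => c a | inr b => d b end),
  (fun i => match fintype.split i with inl a => e a | inr b => f b end) => N.
rewrite big_split_ord xE yE; congr (_ + _); apply: eq_bigr => i _.
  by rewrite -[lshift m i]/(unsplit (inl i)) unsplitK.
by rewrite -[rshift n i]/(unsplit (inr i)) unsplitK.
Qed.

Lemma spans_ext x y : (forall N, x N = y N) -> spans x -> spans y.
Proof. by move=> xy [n [c [e xE]]]; exists n, c, e => N; rewrite -xy. Qed.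

Lemma spans0 : spans (fun _ => 0).
Proof.
exists 0%N, (fun _ => 0), (fun i : 'I_0 => match notF (valP i) with end) => N.
by rewrite big_ord0.
Qed.

End Span.

Notation Krel := (spans (@relator _ _ L rat)).

Definition hf_span (x : R -> rat) : Prop := exists y,
  Krel (fun N => x N - y N) /\
  spans (fun A : {A : R | hom_finite A} => Kclass rat (sval A)) y.

Lemma hf_spanD x y : hf_span x -> hf_span y -> hf_span (fun N => x N + y N).
Proof.
move=> [x' [xx' hx]] [y' [yy' hy]]; exists (fun N => x' N + y' N); split.
  by apply: spans_ext (spansD xx' yy') => N; rewrite opprD addrACA.
exact: spansD.
Qed.

Lemma hf_spanZ a x : hf_span x -> hf_span (fun N => a * x N).
Proof.
move=> [x' [xx' hx]]; exists (fun N => a * x' N); split; last exact: spansZ.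
by apply: spans_ext (spansZ a xx') => N; rewrite mulrBr.
Qed.

Lemma hf_span_ext x y : (forall N, x N = y N) -> hf_span x -> hf_span y.
Proof.
by move=> xy [x' [xx' hx]]; exists x'; split=> //; apply: spans_ext xx' => N; rewrite xy.
Qed.

Lemma hf_span0 : hf_span (fun _ => 0).
Proof.
by exists (fun _ => 0); split; [apply: spans_ext (spans0 _) => N; rewrite subr0|exact: spans0].
Qed.

Lemma hf_span_sum (I : Type) (r : seq I) (P : pred I) (x : I -> R -> rat) :
  (forall i, P i -> hf_span (x i)) -> hf_span (fun N => \sum_(i <- r | P i) x i N).
Proof.
move=> hx; elim: r => [|i r IHr].
  by apply: hf_span_ext hf_span0 => N; rewrite big_nil.
have [Pi|Pi] := boolP (P i); last first.
  by apply: hf_span_ext IHr => N; rewrite big_cons (negPf Pi).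
by apply: hf_span_ext (hf_spanD (hx i Pi) IHr) => N; rewrite big_cons Pi.
Qed.

Lemma hf_span_Krel x y : Krel (fun N => x N - y N) -> hf_span y -> hf_span x.
Proof.
move=> xy [y' [yy' hy]]; exists y'; split=> //.
by apply: spans_ext (spansD xy yy') => N; rewrite addrA subrK.
Qed.

Lemma hf_span_class (A : R) : hom_finite A -> hf_span (Kclass rat A).
Proof.
move=> hA; exists (Kclass rat A); split.
  by apply: spans_ext (spans0 _) => N; rewrite subrr.
exact: (spans_gen (fun A : {A : R | hom_finite A} => Kclass rat (sval A)) (exist _ A hA)).
Qed.

Lemma Krel_exact (a b c : R) (f : Mor a b) (g : Mor b c) :
  exact_pair (f : rep_hom (sval a) (sval b)) (g : rep_hom (sval b) (sval c)) ->
  Krel (fun N => Kclass rat b N - (Kclass rat a N + Kclass rat c N)).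
Proof.
move=> fg; pose e : exact_seq L := ExactSeq (exact_short_exact fg).
apply: spans_ext (spans_gen (@relator _ _ L rat) e) => N.
by rewrite /relator /= opprD addrA.
Qed.

(** With the generators taken one at a time, [F(s)] is an iterated extension of
    the projectives [P(s j)]. *)
Lemma Krel_free n (s : 'I_n -> vertex Q) :
  Krel (fun N => Kclass rat (freeR s) N - \sum_j Kclass rat (freeR (fun _ : unit => s j)) N).
Proof.
elim: n s => [|n IHn] s.
  have ex : exact_pair (rep_id (freeRep s)) (rep_id (freeRep s)).
    have z i (x : space (freeRep s) i) : x = 0 by apply: coef_ext => -[].
    split=> [i v _|]; first exact: z.
    by split=> [i w|i v]; [exists w|split=> _; [exists v|exact: z]].
  apply: spans_ext (spansZ (-1) (Krel_exact (a := freeR s) (b := freeR s) (c := freeR s) ex)) => N.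
  by rewrite big_ord0 subr0 opprD addNKr mulN1r opprK.
pose s' j := s (lift ord0 j).
pose f : rep_hom (freeRep s') (freeRep s) := free_lift lfQ (fun j => gen s (lift ord0 j)).
pose g : rep_hom (freeRep s) (freeRep (fun _ : unit => s ord0)) :=
  free_lift lfQ (fun j => if j == ord0 then vcast (s j) (gen (fun _ : unit => s ord0) tt) else 0).
pose sec : rep_hom (freeRep (fun _ : unit => s ord0)) (freeRep s) :=
  free_lift lfQ (fun _ => gen s ord0).
pose ret : rep_hom (freeRep s) (freeRep s') :=
  free_lift lfQ (fun j => \sum_(a | lift ord0 a == j) vcast (s j) (gen s' a)).
have ex : exact_pair f g.
  apply: (@split_exact _ _ _ _ _ _ _ ret sec).
  - apply: (free_hom_ext lfQ) => j; rewrite -[LHS]/(rmap _ _ (rmap _ _ _)) !lift_gen.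
    rewrite (bigD1 j)//= big1 ?addr0 ?vcast_id// => a /andP[/eqP aj].
    by rewrite (lift_inj aj) eqxx.
  - apply: (free_hom_ext lfQ) => j; rewrite -[LHS]/(rmap _ _ (rmap _ _ _)) !lift_gen.
    by rewrite eq_sym (negPf (neq_lift _ _)).
  - apply: (free_hom_ext lfQ) => -[]; rewrite -[LHS]/(rmap _ _ (rmap _ _ _)).
    by rewrite (lift_gen lfQ (fun _ => gen s ord0) tt) lift_gen eqxx vcast_id.
  apply: (free_hom_ext lfQ) => j.
  rewrite -[LHS]/(rmap f _ (rmap ret _ _) + rmap sec _ (rmap g _ _)) !lift_gen.
  rewrite linear_sum; case: (unliftP ord0 j) => [a ->|->].
    rewrite eq_sym (negPf (neq_lift _ _)) linear0 addr0 (bigD1 a)//= big1 ?addr0.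
      by rewrite vcast_id -[LHS]/(rmap f _ (gen s' a)) lift_gen.
    by move=> b /andP[/eqP ba]; rewrite (lift_inj ba) eqxx.
  by rewrite eqxx vcast_id (lift_gen lfQ (fun _ => gen s ord0) tt) big1 ?add0r//.
have := spansD (Krel_exact (a := freeR s') (b := freeR s)
  (c := freeR (fun _ : unit => s ord0)) ex) (IHn s').
apply: spans_ext => N; rewrite big_ord_recl (addrC (Kclass _ (freeR s') N)).
by rewrite !opprD !addrA subrK.
Qed.

End KTheory.

(** * Spanning, cancellation, and counting morphisms *)

Section Conclusions.
Variables (k : finFieldType) (Q : quiver).
Hypotheses (lfQ : locally_finite Q) (no_path : no_infinite_path Q).
Hypothesis no_loop1 : no_single_loop Q.
Local Notation E := {classic (edge Q)}.
Local Notation gen := (gen k).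
Local Notation freeRep := (freeRep k).
Local Notation R := (obj (Rcat k Q)).
Local Notation L := (Rlin k Q).
Local Notation freeR := (freeR k lfQ no_path).
Local Notation pt i := (freeR (fun _ : unit => i)).
Local Notation Krel := (spans (@relator _ _ L rat)).

Definition loop_at i : pred E := fun e => `[< is_loop e /\ qtail e = i >].

Lemma loops_count_neq1 i (l : seq E) : uniq l -> (forall e, loop_at i e -> e \in l) ->
  count (loop_at i) l != 1%N.
Proof.
move=> ul il; rewrite -size_filter; apply/negP => /eqP s1.
case el: (filter (loop_at i) l) s1 => [|e [|]]// _.
have eP e' : (loop_at i e') = (e' == e).
  rewrite -[RHS](mem_seq1 e' e) -el mem_filter.
  by case: (boolP (loop_at i e')) => // /il ->.
apply: no_loop1; exists i, e; split; first by apply/asboolP; rewrite -/(loop_at i e) eP.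
move=> e' e'P; have /eqP : (e' : E) == e by rewrite -eP; apply/asboolP.
exact: esym.
Qed.

Lemma finite_set_inj (T : Type) (F : finType) (f : T -> F) :
  injective f -> finite_set [set: T].
Proof.
move=> fi; have e : (f @` [set: T] #= [set: T])%card.
  by apply: inj_card_eq => x y _ _; exact: fi.
by rewrite -(eq_finite_set e); exact: finite_finset.
Qed.

(** A morphism to the simple is determined by its values, in finite spaces, at
    finitely many generators. *)
Lemma simple_hom_finite i : hom_finite (Robj (simple_inR k lfQ no_path i)).
Proof.
move=> M; have [n [s [h hs]]] := fg_free_surj lfQ (inR_fg (svalP M)).
pose T := {dffun forall j : 'I_n, 'rV[k]_(`[< s j = i >] : bool)}.
pose f (phi : Mor M (Robj (simple_inR k lfQ no_path i))) : T :=
  finfun (fun j => rmap phi (s j) (rmap h (s j) (gen s j))).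
apply: (@finite_set_inj _ T f) => phi psi pp; apply: rep_hom_ext => j v.
have [x <-] := hs j v.
have -> // : forall y, rmap phi j (rmap h j y) = rmap psi j (rmap h j y).
apply: (@rep_compE _ _ _ _ _ phi h (rep_comp psi h)); apply: (free_hom_ext lfQ) => a.
by have := congr1 (fun z : T => z a) pp; rewrite !ffunE.
Qed.

(** In the class of the resolution [0 -> F -> P -> S -> 0] of the simple [S] at
    [i], the projective [P] occurs in [F] once for each of the [g] loops at [i].
    So [(1 - g) [P]] is [[S]] plus classes of projectives generated at vertices
    of lower rank, and [g] is not 1. *)
Lemma hf_span_pt i : hf_span (Kclass rat (pt i)).
Proof.
have [h hP] := exists_rank lfQ no_path.
elim: {i}(h i).+1 {-2}i (ltnSn (h i)) => [//|n IHn] i; rewrite ltnS => hi.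
pose l := out_edges lfQ i; pose g := count (loop_at i) l.
have g1 : g != 1%N.
  apply: loops_count_neq1; first exact: out_edges_uniq.
  by move=> e /asboolP[_ te]; rewrite mem_out_edges asboolT.
pose S : R := Robj (simple_inR k lfQ no_path i).
have K1 : Krel (fun N => Kclass rat (pt i) N -
    (Kclass rat (freeR (fun a => qhead (@out_edge _ lfQ i a))) N + Kclass rat S N)).
  exact: (Krel_exact (a := freeR _) (b := pt i) (c := S) (simple_exact k lfQ i)).
have := spansD K1 (Krel_free k lfQ no_path (fun a => qhead (@out_edge _ lfQ i a))).
pose rest N := \sum_(e <- l | (e \in l) && ~~ loop_at i e) Kclass rat (pt (qhead e)) N.
have sumE N : \sum_a Kclass rat (pt (qhead (@out_edge _ lfQ i a))) N =
    g%:R * Kclass rat (pt i) N + rest N.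
  rewrite -(big_tnth _ _ l xpredT (fun e : E => Kclass rat (pt (qhead e)) N)).
  rewrite (bigID (loop_at i))/= [X in _ + X]big_seq_cond; congr (_ + _).
  rewrite (eq_bigr (fun _ => Kclass rat (pt i) N)) => [|e /asboolP[le te]].
    by rewrite big_const_seq iter_addr addr0 mulr_natl.
  by rewrite -le te.
move=> K2; have {K1 K2} : Krel (fun N => (1 - g%:R) * Kclass rat (pt i) N -
    (Kclass rat S N + rest N)).
  apply: spans_ext K2 => N; rewrite sumE mulrBl mul1r.
  rewrite (addrC _ (Kclass rat S N)) !opprD !addrA subrK.
  by rewrite -!addrA; congr (_ + _); rewrite addrCA.
move=> /hf_span_Krel; have S_rest : hf_span (fun N => Kclass rat S N + rest N).
  apply: hf_spanD; first exact/hf_span_class/simple_hom_finite.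
  apply: hf_span_sum => e /andP[]; rewrite mem_out_edges => /asboolP te /asboolP le.
  apply: IHn; apply: leq_trans hi; rewrite -te; apply: hP => lp.
  by apply: le.
move=> /(_ S_rest)/(hf_spanZ (1 - g%:R)^-1); apply: hf_span_ext => N.
by rewrite mulrA mulVf ?mul1r// subr_eq0 eq_sym Num.Theory.pnatr_eq1.
Qed.

Lemma hf_span_all (M : R) : hf_span (Kclass rat M).
Proof.
have hf_free n (s : 'I_n -> vertex Q) : hf_span (Kclass rat (freeR s)).
  apply: hf_span_Krel (Krel_free k lfQ no_path s) _.
  by apply: hf_span_sum => j _; exact: hf_span_pt.
have [n [m [t [s [f [g fg]]]]]] := resolutionR lfQ no_path M.
have K := Krel_exact (short_exact_exact lfQ no_path fg).
apply: (hf_span_Krel (y := fun N => Kclass rat (freeR s) N + (-1) * Kclass rat (freeR t) N)).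
  apply: spans_ext (spansZ (-1) K) => N.
  by rewrite !mulN1r !opprD !opprK [RHS]addrCA; congr (_ + _); exact: addrC.
by apply: hf_spanD; [exact: hf_free|apply: hf_spanZ; exact: hf_free].
Qed.

Lemma K_spanned (n : nat) (c : 'I_n -> int) (M : 'I_n -> R) :
  exists (m : nat) (q : 'I_m -> rat) (A : 'I_m -> R),
    (forall j, hom_finite (A j)) /\
    Keq L (lincomb (fun i => (c i)%:~R) M) (lincomb q A).
Proof.
have [y [[m [d [e xyE]]] [l [q [A yE]]]]] :
    hf_span (fun N => \sum_(i < n) (c i)%:~R * Kclass rat (M i) N).
  by apply: hf_span_sum => i _; apply: hf_spanZ; exact: hf_span_all.
exists l, q, (fun j => sval (A j)); split=> [j|]; first exact: svalP.
exists m, d, e => N; rewrite -xyE; congr (_ - _).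
by rewrite /lincomb yE.
Qed.

(** By additivity the indices of [F s] and [F s'] agree; they are the numbers of
    generators at each vertex, so a permutation matches [s] with [s']. *)
Lemma free_cancel (M X : R) n n' (s : 'I_n -> vertex Q) (s' : 'I_n' -> vertex Q)
    (f : rep_hom (sval M) (sval X)) (g : rep_hom (sval X) (freeRep s))
    (f' : rep_hom (sval M) (sval X)) (g' : rep_hom (sval X) (freeRep s')) :
  exact_pair f g -> exact_pair f' g' -> rep_iso (freeRep s) (freeRep s').
Proof.
move=> fg fg'; pose l := pdiv #|k|.
have k1 : (1 < #|k|)%N.
  by rewrite (cardD1 0) (cardD1 1) !inE oner_eq0.
have l_gt0 : (0 < logn l #|k|)%N.
  by rewrite logn_gt0 mem_primes pdiv_prime//= pdiv_dvd (ltnW k1).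
have cnt i : #|[pred j | `[< s j = i >]]| = #|[pred j | `[< s' j = i >]]|.
  have := log_index_unique (rep_indexD fg (ind_rep lfQ i l M) (free_index k lfQ s i l))
    (rep_indexD fg' (ind_rep lfQ i l M) (free_index k lfQ s' i l)).
  by move=> /addrI[/eqP]; rewrite eqn_pmul2r// => /eqP.
pose c m (u : 'I_m -> vertex Q) : m.-tuple {classic vertex Q} := [tuple u j | j < m].
have cntE m (u : 'I_m -> vertex Q) (i : {classic vertex Q}) :
    count_mem i (c m u) = #|[pred j | `[< u j = i >]]|.
  rewrite count_map -sum1_count -sum1_card /=.
  rewrite big_enum_cond /=; apply: eq_bigl => j; rewrite inE /=.
  by apply/eqP/asboolP.
have ss' : perm_eq (c n s) (c n' s').
  by apply/allP => i _ /=; apply/eqP; rewrite !cntE cnt.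
have nn' : n = n' by rewrite -(size_tuple (c n s)) (perm_size ss') size_tuple.
case: _ / nn' in s' g' fg' cnt ss' *.
have /tuple_permP[p pE] := ss'.
apply: (@free_reindex k Q lfQ _ _ s s' p (p^-1)%g); [exact: permK|exact: permKV|].
move=> j; have := congr1 (fun t => nth (s j : {classic vertex Q}) t j) pE.
rewrite -!tnth_nth.
by rewrite !tnth_mktuple.
Qed.

(** Split sequences, with the terms replaced by isomorphic ones. *)
Lemma direct_sum_exact (M P MP X : R) F :
  direct_sum L M P MP -> rep_iso (sval MP) (sval X) -> rep_iso (sval P) F ->
  exists (f : rep_hom (sval M) (sval X)) (g : rep_hom (sval X) F), exact_pair f g.
Proof.
move=> [ia [ib [pa [pb [aa bb ba ab sum]]]]] [u [v [vu uv]]] [a [b [ba' ab']]].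
exists (rep_comp u ia), (rep_comp a (rep_comp pb v)).
apply: (split_exact (r := rep_comp pa v) (s := rep_comp u (rep_comp ib b)));
  apply: rep_hom_ext => i x /=.
- by rewrite (rep_compE vu) (rep_compE aa).
- by rewrite (rep_compE vu) (rep_compE ba) /= linear0.
- by rewrite (rep_compE vu) (rep_compE bb) (rep_compE ab').
rewrite (rep_compE ba') /= -linearD.
rewrite -[X in rmap u i X]/(rmap (rep_add (rep_comp ia pa) (rep_comp ib pb)) i (rmap v i x)).
by rewrite [rep_add _ _]sum (rep_compE uv).
Qed.

Lemma projective_cancel (P P' M : R) : projective P -> projective P' ->
  forall MP MP' : R, direct_sum L M P MP -> direct_sum L M P' MP' ->
  isomorphic MP MP' -> isomorphic P P'.
Proof.
move=> Pp P'p MP MP' sMP sMP' MPi.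
have [n [r Pr]] := projectiveR_free lfQ no_path Pp.
have [n' [r' P'r]] := projectiveR_free lfQ no_path P'p.
have MPid : rep_iso (sval MP') (sval MP') by exists (rep_id _), (rep_id _); split; exact: rep_hom_ext.
have [f [g fg]] := direct_sum_exact sMP MPi Pr.
have [f' [g' fg']] := direct_sum_exact sMP' MPid P'r.
apply: (rep_iso_trans Pr); apply: rep_iso_trans (rep_iso_sym P'r).
exact: free_cancel fg fg'.
Qed.

Lemma hom_finite_space (A : R) i : hom_finite A -> finite_set [set: space (sval A) i].
Proof.
move=> hA; apply: sub_finite_set (finite_image (fun phi : Mor (pt i) A =>
  rmap phi i (gen (fun _ : unit => i) tt)) (hA (pt i))) => v _ /=.
exists (free_lift lfQ (fun _ : unit => v)) => //.
exact: (lift_gen lfQ (fun _ : unit => v) tt).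
Qed.

(** At a vertex [i] with [g] loops, the index of a finite [A] has the valuation of
    the size of [A_i], minus those of the sizes of the [A_(qtail e)] over the edges
    [e] ending at [i]. As the indices of [A] and [B] agree, the difference [D] of
    the valuations of their sizes satisfies [(1 - g) D_i = sum_e D_(qtail e)] over
    the non-loops [e] ending at [i]: it vanishes at [i] once it does at all vertices
    of higher rank. *)
Lemma Keq_size (A B : R) : hom_finite A -> hom_finite B ->
  Keq L (Kclass int A) (Kclass int B) ->
  forall i, size_of [set: space (sval A) i] = size_of [set: space (sval B) i].
Proof.
move=> hA hB AB.
have sz_gt0 (C : R) j : hom_finite C -> (0 < size_of [set: space (sval C) j])%N.
  by move=> hC; apply: (size_of_gt0 (x := 0)) => //; exact: hom_finite_space.
suff eq_log l i : logn l (size_of [set: space (sval A) i]) =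
    logn l (size_of [set: space (sval B) i]).
  by move=> i; apply: eqn_from_log; [exact: sz_gt0|exact: sz_gt0|move=> l; exact: eq_log].
pose D j : int := (logn l (size_of [set: space (sval A) j]))%:Z -
  (logn l (size_of [set: space (sval B) j]))%:Z.
have DE j : D j = \sum_(e <- in_edges lfQ j) D (qtail e).
  have indE (C : R) : hom_finite C -> ind lfQ j l C =
      (logn l (size_of [set: space (sval C) j]))%:Z -
      \sum_(e <- in_edges lfQ j) (logn l (size_of [set: space (sval C) (qtail e)]))%:Z.
    move=> hC; rewrite -(big_morph Posz PoszD (erefl 0%:Z)); apply: indP.
    by apply: finite_rep_index => i'; exact: hom_finite_space.
  have := Keq_additive (ind_exact lfQ no_path j l) AB; rewrite !indE// => /eqP.
  by rewrite subr_eq /D sumrB => /eqP->; rewrite addrAC (addrC _%:Z) addrK addrC.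
suff : D i = 0 by move=> /eqP; rewrite subr_eq0 eqz_nat => /eqP.
have [h hP] := exists_rank lfQ no_path.
pose supp (C : R) := [set j | exists v : space (sval C) j, v != 0].
have [s sP] : exists s : seq {classic vertex Q}, supp A `|` supp B = [set` s].
  apply/finite_seqP; rewrite finite_setU; split.
    by have [] := svalP A.
  by have [] := svalP B.
have D0 j : (j : {classic vertex Q}) \notin s -> D j = 0.
  move=> js; have z (C : R) : (supp C `<=` [set` s]) -> size_of [set: space (sval C) j] = 1%N.
    move=> Cs; rewrite (_ : [set: _] = [set 0]) ?/size_of ?fset_set1 ?cardfs1//.
    apply/seteqP; split=> // v _ /=; apply/eqP; apply: contraNT js => v0.
    by apply: Cs; exists v.
  by rewrite /D !z ?subrr// -sP => x; [right|left].
(* descending induction on the rank, which is bounded on the supports *)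
pose N := (\max_(j <- s) h j)%N.
have : (N - h i < (N - h i).+1)%N by [].
elim: (N - h i).+1 {1 3}i => [//|n IHn] {}i ni.
have [ins|/D0//] := boolP ((i : {classic vertex Q}) \in s).
have hi : (h i <= N)%N by exact: (@leq_bigmax_seq {classic vertex Q} s xpredT h i).
have := DE i; rewrite (bigID (loop_at i))/= [X in _ + X]big_seq_cond.
rewrite [X in _ + X]big1 ?addr0 => [|e /andP[]]; last first.
  rewrite mem_in_edges => /asboolP ei /asboolP le.
  have [tes|/D0//] := boolP ((qtail e : {classic vertex Q}) \in s).
  have hte : (h i < h (qtail e))%N.
    by rewrite -ei; apply: hP => lp; apply: le; rewrite -ei.
  have hteN : (h (qtail e) <= N)%N.
    by exact: (@leq_bigmax_seq {classic vertex Q} s xpredT h (qtail e)).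
  apply: IHn; apply: leq_trans (_ : N - h i <= n)%N; last by [].
  by apply: ltn_sub2l => //; exact: leq_trans hteN.
rewrite (eq_bigr (fun _ => D i)) => [|e /asboolP[_ ->]//].
rewrite big_const_seq iter_addr addr0 => /eqP.
have g1 : count (loop_at i) (in_edges lfQ i) != 1%N.
  apply: loops_count_neq1; first exact: in_edges_uniq.
  by move=> e /asboolP[le te]; rewrite mem_in_edges -le te asboolT.
rewrite -subr_eq0 -{1}[D i]mulr1n -mulr_natl -[D i *+ _]mulr_natl -mulrBl mulf_eq0.
by rewrite subr_eq0 eq_sym Num.Theory.pnatr_eq1 (negPf g1) => /eqP.
Qed.

Lemma card_le_inj (T U : Type) (f : T -> U) : injective f -> ([set: T] #<= [set: U])%card.
Proof.
move=> fi; have e : (f @` [set: T] #= [set: T])%card.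
  by apply: inj_card_eq => x y _ _; exact: fi.
rewrite -(card_le_eql e); exact: subset_card_le.
Qed.

(** Morphisms from a free representation are families of elements at the vertices
    of its generators, so injections [A_i -> B_i] apply to them. *)
Lemma free_hom_card_le (P A B : R) (n : nat) (r : 'I_n -> vertex Q) :
  rep_iso (sval P) (freeRep r) ->
  (forall i, ([set: space (sval A) i] #= [set: space (sval B) i])%card) ->
  ([set: Mor P A] #<= [set: Mor P B])%card.
Proof.
move=> [u [v [vu uv]]] AB.
have inj i : exists f : space (sval A) i -> space (sval B) i, injective f.
  have /card_bijP[f /bij_inj fi] := AB i.
  exists (fun x => val (f (SigSub (mem_set (I : [set: space (sval A) i] x))))).
  by move=> x y /val_inj/fi[].
pose b i := sval (cid (inj i)); have b_inj i : injective (b i) by rewrite /b; case: cid.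
pose F (phi : Mor P A) : Mor P B := rep_comp
  (free_lift lfQ (fun j => b _ (rmap phi (r j) (rmap v (r j) (gen r j))))) u.
apply: (card_le_inj (f := F)) => phi psi FF.
have vE : rep_comp (phi : rep_hom (sval P) _) v = rep_comp psi v.
  apply: (free_hom_ext lfQ) => j; apply: (b_inj (r j)).
  have := congr1 (fun h : rep_hom (sval P) (sval B) => rmap h (r j) (rmap v (r j) (gen r j))) FF.
  rewrite -[rmap (F phi) _ _]/(rmap _ _ (rmap u _ _)) -[rmap (F psi) _ _]/(rmap _ _ (rmap u _ _)).
  by rewrite (rep_compE uv) !lift_gen.
apply: rep_hom_ext => i x; rewrite -[x]/(rmap (rep_id (sval P)) i x) -vu.
exact: (rep_compE vE).
Qed.

Lemma Keq_hom_card (A B : R) : hom_finite A -> hom_finite B ->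
  Keq L (Kclass int A) (Kclass int B) ->
  forall P : R, projective P -> ([set: Mor P A] #= [set: Mor P B])%card.
Proof.
move=> hA hB AB P /(projectiveR_free lfQ no_path)[n [r Pr]].
have eqAB i : ([set: space (sval A) i] #= [set: space (sval B) i])%card.
  by apply: eq_size_of; [exact: hom_finite_space|exact: hom_finite_space|exact: Keq_size].
apply/card_eqPle; split; apply: (free_hom_card_le Pr) => // i.
by rewrite card_eq_sym.
Qed.

End Conclusions.

Theorem proposition5p7 (k : finFieldType) (Q : quiver)
    (hQ : locally_finite Q) (hA : no_infinite_path Q) (hB : no_single_loop Q) :
  let R := Rcat k Q in
  let L := Rlin k Q in
  (essentially_small R /\ is_linear L) /\
  (gldim_le L 1 /\ enough_projectives R) /\
  (forall P P' M : R, projective P -> projective P' -> projective M ->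
     forall MP MP' : R, direct_sum L M P MP -> direct_sum L M P' MP' ->
     isomorphic MP MP' -> isomorphic P P') /\
  (forall (n : nat) (c : 'I_n -> int) (M : 'I_n -> R),
     exists (m : nat) (q : 'I_m -> rat) (A : 'I_m -> R),
       (forall j, hom_finite (A j)) /\
       Keq L (lincomb (fun i => (c i)%:~R) M) (lincomb q A)) /\
  (forall A B : R, hom_finite A -> hom_finite B ->
     Keq L (Kclass int A) (Kclass int B) ->
     forall P : R, projective P -> ([set: Mor P A] #= [set: Mor P B])%card).
Proof.
move=> R L; split; first by split; [exact: essentially_smallR|exact: linearR].
split; first by split; [exact: gldimR|exact: enough_projectivesR].
split; first by move=> P P' M Pp P'p _; exact: projective_cancel.
split; first exact: K_spanned.
exact: Keq_hom_card.
Qed.
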